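(* Let $1<p,q<\infty$ with $\frac1p+\frac1q=1$, and suppose $(E(|u|^q))^{p/q}E(|w|^p)<\infty$ a.e. $\mu$. Then the WCT operator $M_wEM_u:\mathcal{D}(M_wEM_u)\to L^p(\Sigma)$ is continuous if and only if it is everywhere defined, i.e. $\mathcal{D}(M_wEM_u)=L^p(\Sigma)$.
   Context: $(\Omega,\Sigma,\mu)$ is a $\sigma$-finite measure space and $\mathcal{A}\subseteq\Sigma$ is a $\sigma$-subalgebra such that $(\Omega,\mathcal{A},\mu)$ is also $\sigma$-finite. $L^p(\Sigma)=L^p(\mu)=L^p(\Omega,\Sigma,\mu)$ (complex-valued functions). Comparisons between functions or sets hold up to $\mu$-null sets. $E=E^{\mathcal{A}}$ is the conditional expectation with respect to $\mathcal{A}$: for $f\ge0$ $\Sigma$-measurable (then $E(f)$ may take values in $[0,\infty]$) or $f\in L^p(\Sigma)$, $E(f)$ is the unique $\mathcal{A}$-measurable function with $\int_A f\,d\mu=\int_A E(f)\,d\mu$ for all $A\in\mathcal{A}$ for which the integrals exist. For a general complex-valued $\Sigma$-measurable $f$, $E(f)$ is understood to be defined when $E(|f|)<\infty$ a.e. (by linearity from nonnegative functions). The functions $u,w:\Omega\to\mathbb{C}$ are $\Sigma$-measurable and conditionable, i.e. $E(u)$ and $E(w)$ are defined. The weighted conditional type (WCT) operator $M_wEM_u$ in $L^p(\Sigma)$ is $f\mapsto wE(uf)$ with domain $\mathcal{D}(M_wEM_u)=\{f\in L^p(\Sigma): wE(uf)\in L^p(\Sigma)\}$ (which includes the requirement that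 $E(uf)$ is defined).
   Formalization: The finiteness hypothesis is read as excluding, up to a null set, points where E(|u|^q)=∞ and E(|w|^p)=0; if ∞·0=0 counted as finite the claim fails (w=0, A trivial on [0,1], u in L^1 but not L^q). The form 0·∞ is still allowed and counts as 0. *)

(* Defs.v *)
From HB Require Import structures.
From mathcomp Require Import all_boot all_order all_algebra.
From mathcomp Require Import all_classical all_reals all_analysis.
From mathcomp Require Import measurable_realfun complex.

Set Implicit Arguments.
Unset Strict Implicit.
Unset Printing Implicit Defensive.

Import Order.TTheory GRing.Theory Num.Theory.
Import numFieldNormedType.Exports.

Local Open Scope classical_set_scope.
Local Open Scope ring_scope.
Local Open Scope complex_scope.

(* Real-valued modulus; the library's `|z| is again an element of R[i]. *)
Definition modulus {R : realType} (z : R[i]) : R :=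
  ComplexField.Normc.normc z.

(* The Borel sigma-algebra of C is that of R * R. *)
Definition cmeasurable {d : measure_display} {T : measurableType d}
    {R : realType} (f : T -> R[i]) : Prop :=
  measurable_fun [set: T] (fun x => complex.Re (f x)) /\
  measurable_fun [set: T] (fun x => complex.Im (f x)).

Section condexp.
Context {d : measure_display} {T : measurableType d} {R : realType}.
Variables (mu : {measure set T -> \bar R}) (A : set (set T)).

Local Open Scope ereal_scope.

(* [g] is a version of the conditional expectation of [f >= 0]. When [A] is a
   sigma-algebra, the measurable sets of [g_sigma_algebraType A] are exactly
   the members of [A]. *)
Definition is_condexp (f g : T -> \bar R) : Prop :=
  [/\ measurable_fun [set: g_sigma_algebraType A] g,
      (forall x, 0 <= g x) &
      forall B, A B -> \int[mu]_(x in B) g x = \int[mu]_(x in B) f x].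

(* A chosen version; it is unique up to a mu-null set, and it exists for every
   nonnegative measurable [f] when mu is sigma-finite on [A]
   (Radon-Nikodym), so the default value of [xget] is irrelevant there. *)
Definition condexp_ge0 (f : T -> \bar R) : T -> \bar R :=
  xget (cst 0) [set g | is_condexp f g].

(* E(f) is defined: f is measurable and E(|f|) < +oo a.e. *)
Definition conditionable (f : T -> R[i]) : Prop :=
  cmeasurable f /\
  {ae mu, forall x, condexp_ge0 (fun y => (modulus (f y))%:E) x < +oo}.

Local Open Scope ring_scope.

Definition condexp_real (f : T -> R) : T -> R := fun x =>
  fine (condexp_ge0 (EFin \o f^\+) x) - fine (condexp_ge0 (EFin \o f^\-) x).

(* Meaningful when [f] is conditionable: the values +oo that [fine] sends to 0
   then occur on a mu-null set only. *)
Definition condexp (f : T -> R[i]) : T -> R[i] := fun x =>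
  condexp_real (fun y => complex.Re (f y)) x +i*
  condexp_real (fun y => complex.Im (f y)) x.

End condexp.

Section wct.
Context {d : measure_display} {T : measurableType d} {R : realType}.
Variables (mu : {measure set T -> \bar R}) (A : set (set T)) (p : R).

(* Elements of L^p are represented by functions, and equality in L^p is
   equality a.e., i.e. being at [cLnorm] distance 0. *)
Definition cLnorm (f : T -> R[i]) : \bar R :=
  Lnorm mu p%:E (fun x => (modulus (f x))%:E).

Definition cLp : set (T -> R[i]) :=
  [set f | cmeasurable f /\ (cLnorm f < +oo)%E].

Definition wct (w u : T -> R[i]) (f : T -> R[i]) : T -> R[i] :=
  fun x => w x * condexp mu A (fun y => u y * f y) x.

Definition wct_dom (w u : T -> R[i]) : set (T -> R[i]) :=
  [set f | [/\ cLp f, conditionable mu A (fun y => u y * f y) &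
               cLp (wct w u f)]].

Definition Lp_continuous_on (D : set (T -> R[i]))
    (F : (T -> R[i]) -> (T -> R[i])) : Prop :=
  forall f, D f -> forall e : R, 0 < e -> exists2 r : R, 0 < r &
    forall g, D g -> (cLnorm (fun x => (g x - f x)%R) < r%:E)%E ->
      (cLnorm (fun x => (F g x - F f x)%R) < e%:E)%E.

End wct.

(* Main.v *)
From HB Require Import structures.
Require Import Defs.
From mathcomp Require Import all_boot all_order all_algebra.
From mathcomp Require Import all_classical all_reals all_analysis.
From mathcomp Require Import measurable_realfun complex.
From mathcomp Require Import ring lra.
Import Order.TTheory GRing.Theory Num.Theory.
Import numFieldNormedType.Exports.
Local Open Scope classical_set_scope.
Local Open Scope ring_scope.

(** Write U = E(|u|^q), W = E(|w|^p) and J = U^(p/q) W for the symbol of the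
    operator M : f |-> w E(uf).  These functions are A-measurable, and the
    hypothesis makes U and J finite almost everywhere.  Continuity of M and
    totality of its domain are both equivalent to J being essentially bounded.

    If J <= C, the conditional Hoelder inequality (E|uf|)^p <= U^(p/q) E(|f|^p)
    ([condexp_hoelder]) can be integrated against |w|^p.  Pulling the
    A-measurable factor out of the conditional expectation replaces |w|^p by W,
    so that |Mf|_p^p is at most a constant times the integral of J E(|f|^p),
    hence at most a constant times C |f|_p^p.  Applied to differences this is
    [wct_lipschitz], from which both properties follow.

    Conversely, Hoelder's inequality is an equality for the functions
    f = h conj(u) |u|^(q-2) with h >= 0 A-measurable.  For them E(uf) = h U, so
    that |f|_p^p is the integral of h^p U and |Mf|_p^p that of h^p J U
    ([energy_aligned], [energy_wct_aligned]): on these functions M acts like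
    multiplication by J^(1/p) on L^p(U mu).  When J is unbounded, taking h^p
    concentrated on a set where J > C gives functions of prescribed norm whose
    images are as large as desired, against continuity at 0
    ([concentrated_weight]).  Summing such weights h^p, with C growing faster
    than their masses decrease, gives an f in L^p with Mf outside L^p
    ([resonant_weight]); this gliding hump takes the place of the closed graph
    theorem.

    The conditional expectations in use are those of nonnegative functions
    whose integrals may be infinite even on sets of finite measure, so U and W
    are not finite from the start.  They exist because such a function is a
    countable sum of integrable pieces, each with a Radon-Nikodym derivative
    ([condexp_exists]). *)

Set Implicit Arguments.
Unset Strict Implicit.
Unset Printing Implicit Defensive.

(** * Integration against a function measurable for a sub-sigma-algebra *)


Section subalgebra.
Context {d : measure_display} {T : measurableType d} {R : realType}.
Variables (mu : {measure set T -> \bar R}) (A : set (set T)).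
Hypothesis Asigma : sigma_algebra [set: T] A.
Hypothesis Asub : A `<=` @measurable d T.

Local Notation TA := (g_sigma_algebraType A).
Local Open Scope ereal_scope.

Lemma subalgebra_measurableE : @measurable _ TA = A.
Proof. exact: measurable_g_measurableTypeE. Qed.

Lemma measurable_in_subalgebra (B : set T) : @measurable _ TA B -> A B.
Proof. by rewrite subalgebra_measurableE. Qed.

Lemma subalgebra_setT : A [set: T].
Proof. by have [A0 AC _] := Asigma; have := AC set0 A0; rewrite setD0. Qed.

Lemma subalgebra_measurable (B : set T) : @measurable _ TA B -> measurable B.
Proof. by rewrite subalgebra_measurableE => /Asub. Qed.

Lemma subalgebra_measurable_fun d' (T' : measurableType d') (f : T -> T') :
  measurable_fun [set: TA] f -> measurable_fun [set: T] f.
Proof. by move=> mf _ Y mY; exact: subalgebra_measurable (mf measurableT Y mY). Qed.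

Import HBNNSimple.

(** Approximating [h] by simple functions of the sub-sigma-algebra expresses the
    integral of [h * f] through integrals of [f] over sets of [A] only; this is
    all that a conditional expectation of [f] has in common with [f]. *)
Lemma integral_mul_simple_limit (h f : T -> \bar R) (B : set T)
    (mB : @measurable _ TA B) (mh : measurable_fun (B : set TA) h) :
  (forall x, 0 <= h x) -> measurable_fun [set: T] f -> (forall x, 0 <= f x) ->
  \int[mu]_(x in B) (h x * f x) =
  limn (fun n => \sum_(y \in range (nnsfun_approx mB mh n))
     y%:E * \int[mu]_(x in B `&` nnsfun_approx mB mh n @^-1` [set y]) f x).
Proof.
move=> h0 mf f0.
have mBT := subalgebra_measurable mB.
set s := nnsfun_approx mB mh.
have ms n : measurable_fun [set: T] (s n).
  by apply: subalgebra_measurable_fun; exact: measurable_funP.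
have msr n r : measurable (s n @^-1` [set r] : set T).
  by rewrite -[X in measurable X]setTI; exact: ms.
have shx x : B x -> EFin \o (s ^~ x) @ \oo --> h x.
  by move=> Bx; exact: cvg_nnsfun_approx.
have nds x : {homo s^~ x : a b / (a <= b)%N >-> (a <= b)%R}.
  by move=> a b ab; exact/lefP/nd_nnsfun_approx.
have hf x : B x -> h x * f x = limn (fun n => (s n x)%:E * f x).
  move=> Bx; apply/esym/cvg_lim => //.
  have := f0 x; case: (f x) => [r _|_|//].
    by apply: cvgeZr => //; exact: shx.
  (* At an infinite value of [f] the products converge also when [h x = 0],
     because the approximations of [h] from below are then all 0 at [x]. *)
  have [hx0|hx0] := eqVneq (h x) 0.
    have sn0 n : s n x = 0%R.
      have := @le_approx _ TA R B h n x (fun x _ => h0 x) Bx.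
      rewrite hx0 /s nnsfun_approxE lee_fin => sn0; apply/eqP.
      by rewrite eq_le sn0/= -nnsfun_approxE fun_ge0.
    under eq_fun do rewrite sn0 mul0e.
    by rewrite hx0 mul0e; exact: cvg_cst.
  apply: cvgeM; last exact: cvg_cst; last exact: shx.
  by rewrite mule_def_neq0_infty.
rewrite (eq_integral (fun x : T => limn (fun n => (s n x)%:E * f x))); last first.
  by move=> x /[!inE]; exact: hf.
rewrite monotone_convergence//; last 3 first.
- move=> n; apply: emeasurable_funM; apply: measurable_funTS => //.
  exact/measurable_EFinP.
- by move=> n x Bx; rewrite mule_ge0// lee_fin.
- by move=> x Bx a b ab; rewrite lee_wpmul2r// lee_fin nds.
congr (lim (_ @ \oo)); apply/funext => n.
transitivity (\int[mu]_(x in B) (\sum_(y \in range (s n))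
    (y * \1_(s n @^-1` [set y]) x)%:E * f x)).
  apply: eq_integral => x _.
  rewrite -ge0_mule_fsuml => [|y]; last exact: nnfun_muleindic_ge0.
  by congr (_ * _); rewrite [in LHS]fimfunE -fsumEFin.
rewrite ge0_integral_fsum//; last 2 first.
  - move=> y; apply: emeasurable_funM; apply: measurable_funTS => //.
    by apply/measurable_EFinP; exact: measurable_funM.
  - by move=> m y Ey; rewrite mule_ge0 ?f0// nnfun_muleindic_ge0.
apply: eq_fsbigr => r; rewrite inE => -[t _ <-].
under eq_integral do rewrite EFinM -muleA.
rewrite ge0_integralZl//.
- congr (_ * _); rewrite integral_mkcondr epatch_indic.
  by apply: eq_integral => x _; rewrite muleC.
- apply: emeasurable_funM; last exact/measurable_funTS.
  by apply/measurable_EFinP/measurable_funTS.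
- by move=> x Bx; rewrite mule_ge0 ?lee_fin ?f0.
- by rewrite lee_fin.
Qed.

Lemma integral_mul_subalgebra (f g h : T -> \bar R) (B : set T) :
  measurable_fun [set: T] f -> (forall x, 0 <= f x) ->
  measurable_fun [set: T] g -> (forall x, 0 <= g x) ->
  (forall C, A C -> \int[mu]_(x in C) f x = \int[mu]_(x in C) g x) ->
  measurable_fun [set: TA] h -> (forall x, 0 <= h x) -> A B ->
  \int[mu]_(x in B) (h x * f x) = \int[mu]_(x in B) (h x * g x).
Proof.
move=> mf f0 mg g0 fg mh h0 AB.
have mB : @measurable _ TA B by rewrite subalgebra_measurableE.
have mhB : measurable_fun (B : set TA) h by exact: measurable_funTS.
rewrite (integral_mul_simple_limit mB mhB)//.
rewrite (integral_mul_simple_limit mB mhB)//.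
congr (lim (_ @ \oo)); apply/funext => n; apply: eq_fsbigr => y _; congr (_ * _).
by apply: fg; apply: measurable_in_subalgebra; exact: measurableI.
Qed.

End subalgebra.

(** * Existence and uniqueness of conditional expectations *)

(** Radon-Nikodym with finiteness as hypotheses on the two measures rather than
    as part of their structures, for measures that are built inside a proof. *)
Lemma density_exists {d : measure_display} {S : measurableType d} {R : realType}
    (la nu : {measure set S -> \bar R}) :
  sigma_finite [set: S] la -> (nu [set: S] < +oo)%E -> nu `<< la ->
  exists g : S -> \bar R, [/\ measurable_fun [set: S] g,
    (forall x, 0 <= g x)%E &
    forall B, measurable B -> nu B = (\int[la]_(x in B) g x)%E].
Proof.
move=> sla fnu dom.
have fin : fin_num_fun nu.
  move=> B mB; rewrite ge0_fin_numE//; apply: le_lt_trans fnu.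
  by apply: le_measure => //; rewrite inE.
pose L1 := isSFinite.Build _ _ _ _ (sfinite_measure_sigma_finite sla).
pose L2 := isSigmaFinite.Build _ _ _ _ sla.
pose la' := HB.pack_for (sigma_finite_measure S R) (Measure.sort la) L1 L2.
have snu : sigma_finite [set: S] nu.
  by apply: fin_num_fun_sigma_finite => //; rewrite measure0.
pose N1 := isSFinite.Build _ _ _ _ (sfinite_measure_sigma_finite snu).
pose N2 := isSigmaFinite.Build _ _ _ _ snu.
pose N3 := isFinite.Build _ _ _ _ fin.
pose nu' := HB.pack_for (FiniteMeasure.type S R) (Measure.sort nu) N1 N2 N3.
have [g [g0 _ ig gE]] := @radon_nikodym_sigma_finite _ _ _ la' nu' dom.
by exists g; split => //; exact: measurable_int ig.
Qed.

Section condexp_theory.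
Context {d : measure_display} {T : measurableType d} {R : realType}.
Variables (mu : {measure set T -> \bar R}) (A : set (set T)).
Hypothesis Asigma : sigma_algebra [set: T] A.
Hypothesis Asub : A `<=` @measurable d T.
Hypothesis Afin : sigma_finite [set: g_sigma_algebraType A] mu.

Local Notation TA := (g_sigma_algebraType A).
Local Open Scope ereal_scope.

(** Where [g < f] with [g <= n], on a set of finite measure, the integral of [g]
    is finite, so that of [f - g > 0] is at most 0 and the set is null.
    Countably many such sets cover the points with [g < f]. *)
Lemma ae_le_subalgebra (f g : T -> \bar R) :
  measurable_fun [set: TA] f -> (forall x, 0 <= f x) ->
  measurable_fun [set: TA] g -> (forall x, 0 <= g x) ->
  (forall B, A B -> \int[mu]_(x in B) f x <= \int[mu]_(x in B) g x) ->
  {ae mu, forall x, f x <= g x}.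
Proof.
move=> mf f0 mg g0 fg; have [F TF /all_and2[mF Ffin]] := Afin.
have mfT := subalgebra_measurable_fun Asigma Asub mf.
have mgT := subalgebra_measurable_fun Asigma Asub mg.
pose B n m : set T := (F m : set T) `&` [set x | g x <= n%:R%:E] `&` [set x | g x < f x].
have mB n m : @measurable _ TA (B n m).
  apply: measurableI; first apply: measurableI => //.
    by rewrite -[X in measurable X]setTI; exact: emeasurable_fun_infty_c.
  by rewrite -[X in measurable X]setTI; exact: emeasurable_fun_lt.
have mBT n m : measurable (B n m) by exact: (subalgebra_measurable Asigma Asub).
suff B0 n m : mu.-negligible (B n m).
  apply: (@negligibleS _ _ _ _ (\bigcup_n \bigcup_m B n m)); last first.
    by apply: negligible_bigcup => n; exact: negligible_bigcup.
  move=> x /= /negP; rewrite -ltNge => gfx.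
  have gfin : g x \is a fin_num by rewrite ge0_fin_numE// (lt_le_trans gfx)// leey.
  have : [set: T] x by []. rewrite TF => -[m _ Fmx].
  have /archi_boundP/ltW gn : (0 <= fine (g x))%R by exact: fine_ge0.
  exists (Num.bound (fine (g x))) => //; exists m => //; split => //; split => //=.
  by rewrite -(fineK gfin) lee_fin.
have gfinB x : B n m x -> g x \is a fin_num.
  by move=> [[_ /= gn] _]; rewrite ge0_fin_numE// (le_lt_trans gn)// ltry.
have intg : \int[mu]_(x in B n m) g x \is a fin_num.
  rewrite ge0_fin_numE; last exact: integral_ge0.
  apply: (@le_lt_trans _ _ (\int[mu]_(x in B n m) cst n%:R%:E x)).
    apply: ge0_le_integral => //; [exact: measurable_funTS|].
    by move=> x [[_ ]].
  rewrite integral_cst// lte_mul_pinfty//.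
  apply: le_lt_trans (Ffin m); apply: le_measure => //; rewrite ?inE//.
    exact: (subalgebra_measurable Asigma Asub).
  by move=> x [[]].
have mfg : measurable_fun (B n m) (fun x => f x - g x).
  by apply: measurable_funTS; exact: emeasurable_funB.
have fg0 x : B n m x -> 0 <= f x - g x.
  by move=> Bx; rewrite sube_ge0 ?gfinB//; case: Bx => _ /ltW.
have int0 : \int[mu]_(x in B n m) (f x - g x) = 0.
  apply/eqP; rewrite eq_le integral_ge0// andbT.
  rewrite -(leeD2rE _ _ intg) add0e -ge0_integralD//; last exact: measurable_funTS.
  rewrite (eq_integral f); last by move=> x /[!inE] Bx; rewrite subeK// gfinB.
  by apply: fg; exact: (measurable_in_subalgebra Asigma).
have /(ae_eq_integral_abs mu (mBT n m) mfg) :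
    \int[mu]_(x in B n m) `|f x - g x| = 0.
  rewrite -int0; apply: eq_integral => x /[!inE] Bx.
  by rewrite gee0_abs// fg0.
apply: negligibleS => x Bx /= /(_ Bx) fgx; case: (Bx) => _ /=.
by rewrite -[f x](subeK _ (gfinB x Bx)) fgx add0e ltxx.
Qed.

(** The function [f] may have infinite integral over every set of [A] of
    positive measure.  It is cut along disjoint sets [D n] of finite measure on
    which [f <= n]; each piece has a density on [A], and these are summed. *)
Lemma condexp_exists (f : T -> R) :
  measurable_fun [set: T] f -> (forall x, 0 <= f x)%R ->
  exists g, is_condexp mu A (EFin \o f) g.
Proof.
move=> mf f0.
have mfE : measurable_fun [set: T] (EFin \o f) by exact/measurable_EFinP.
(* [mu] seen as a measure on the measurable space [TA]. *)
pose la0 : set TA -> \bar R := mu.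
have la00 : la0 set0 = 0 by exact: measure0.
have la0_ge0 B : 0 <= la0 B by exact: measure_ge0.
have la0_sa : semi_sigma_additive la0.
  move=> F mF tF mUF; apply: measure_semi_sigma_additive => //.
  - by move=> n; exact: (subalgebra_measurable Asigma Asub).
  - exact: (subalgebra_measurable Asigma Asub).
pose la : {measure set TA -> \bar R} :=
  HB.pack_for (measure TA R) la0 (isMeasure.Build _ _ _ _ la00 la0_ge0 la0_sa).
have laE (g : T -> \bar R) (B : set T) : @measurable _ TA B ->
    measurable_fun [set: TA] g -> (forall x, 0 <= g x) ->
    \int[la]_(x in B) g x = \int[mu]_(x in B) g x.
  move=> mB mg g0.
  have mid : measurable_fun [set: T] (id : T -> TA).
    by move=> _ Y mY; rewrite setTI; exact: (subalgebra_measurable Asigma Asub).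
  rewrite -(@ge0_integral_pushforward _ _ _ _ _ _ mid mu B g)//.
  exact: measurable_funTS.
have /sigma_finiteP[F [TF ndF /all_and2[mF Ffin]]] : sigma_finite [set: TA] la.
  exact: Afin.
have mFT n : measurable (F n : set T) by exact: (subalgebra_measurable Asigma Asub).
pose V n : set T := (F n : set T) `&` [set x | f x <= n%:R]%R.
have mV n : measurable (V n).
  apply: measurableI => //; rewrite -[X in measurable X]setTI.
  exact: measurable_fun_le.
have VT : \bigcup_n V n = setT.
  apply/seteqP; split => // x _.
  have : [set: T] x by []. rewrite TF => -[m _ Fmx].
  have /ltW := archi_boundP (f0 x); set n := Num.bound _ => fn.
  exists (maxn m n) => //; split.
    by apply: (subsetPset _ _ (ndF _ _ (leq_maxl m n))).
  by rewrite /= (le_trans fn)// ler_nat leq_maxr.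
pose D := seqDU V.
have mD n : measurable (D n).
  by apply: measurableD => //; exact: bigsetU_measurable.
have DT : \bigcup_n D n = setT by rewrite -seqDU_bigcup_eq.
have tD : trivIset setT D := trivIset_seqDU V.
pose nu0 n : set TA -> \bar R := fun B => \int[mu]_(x in B `&` D n) (f x)%:E.
have nu00 n : nu0 n set0 = 0 by rewrite /nu0 set0I integral_set0.
have nu0_ge0 n B : 0 <= nu0 n B.
  by apply: integral_ge0 => x _; rewrite lee_fin.
have nu0_sa n : semi_sigma_additive (nu0 n).
  move=> G mG tG mUG; rewrite /nu0 setI_bigcupl.
  have tGD : trivIset setT (fun i => G i `&` D n) by exact: trivIset_setIr.
  have mGD i : measurable (G i `&` D n : set T).
    by apply: measurableI => //; exact: (subalgebra_measurable Asigma Asub).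
  apply: (semi_sigma_additive_nng_induced mfE) => //.
  exact: bigcup_measurable.
pose nu n : {measure set TA -> \bar R} := HB.pack_for (measure TA R) (nu0 n)
  (isMeasure.Build _ _ _ _ (nu00 n) (nu0_ge0 n) (nu0_sa n)).
have nufin n : nu n setT < +oo.
  rewrite /= /nu0 setTI.
  apply: (@le_lt_trans _ _ (\int[mu]_(x in D n) cst n%:R%:E x)).
    apply: ge0_le_integral => //.
    - by move=> x _; rewrite lee_fin.
    - exact: measurable_funTS.
    - by move=> x [[_ /=]]; rewrite lee_fin.
  rewrite integral_cst// lte_mul_pinfty//.
  apply: le_lt_trans (Ffin n); apply: le_measure => //; rewrite ?inE//.
  by move=> x [[]].
have nudom n : nu n `<< la.
  apply/null_content_dominatesP => B mB laB0.
  have mBT : measurable (B : set T) by exact: (subalgebra_measurable Asigma Asub).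
  apply: null_set_integral; [exact: measurableI|exact: measurable_funTS|].
  have mBD : measurable ((B : set T) `&` D n) by exact: measurableI.
  apply/eqP; rewrite -measure_le0 -[X in _ <= X]laB0.
  by apply: le_measure; rewrite ?inE//; exact: subIsetl.
have [g /all_and3[mg g0 gE]] :=
  choice (fun n => density_exists (la := la) Afin (nufin n) (nudom n)).
exists (fun x => \sum_(n <oo) g n x); split.
- exact: ge0_emeasurable_sum.
- by move=> x; exact: nneseries_ge0.
move=> B AB; have mB : @measurable _ TA B by rewrite subalgebra_measurableE.
have mBT : measurable B by exact: Asub.
rewrite integral_nneseries//; last first.
  by move=> n; apply: measurable_funTS; exact: (subalgebra_measurable_fun Asigma Asub).
under eq_eseriesr do rewrite -laE// -gE//.
have BE : B = \bigcup_n (B `&` D n) by rewrite -setI_bigcupr DT setIT.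
rewrite [in RHS]BE ge0_integral_bigcup//.
- by move=> n; exact: measurableI.
- exact: measurable_funTS.
- by move=> x _; rewrite lee_fin.
- exact: trivIset_setIl.
Qed.

Lemma condexpP (f : T -> R) :
  measurable_fun [set: T] f -> (forall x, 0 <= f x)%R ->
  is_condexp mu A (EFin \o f) (condexp_ge0 mu A (EFin \o f)).
Proof.
move=> mf f0; rewrite /condexp_ge0.
by case: xgetP => // noE; have [g /noE] := condexp_exists mf f0.
Qed.

End condexp_theory.

(** * Inequalities for conditional expectations *)

Section powR_limits.
Context {R : realType}.

Lemma measurable_fun_powR d (S : measurableType d) (D : set S) (f : S -> R)
    (r : R) :
  measurable_fun D f -> measurable_fun D (fun x => f x `^ r).
Proof. by move=> mf; exact: (measurableT_comp (@measurable_powR R r) mf). Qed.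

(** The point [y = 0] is included: Hoelder's inequality is needed where the
    conditional expectations vanish, where the power need not be differentiable. *)
Lemma cvg_powR_inv_shift (y r : R) : 0 <= y -> 0 < r ->
  (y + n.+1%:R^-1) `^ r @[n --> \oo] --> y `^ r.
Proof.
move=> y0 r0.
have cvgy : y + n.+1%:R^-1 @[n --> \oo] --> y.
  rewrite -[X in _ --> X]addr0; apply: cvgD; first exact: cvg_cst.
  exact: cvg_harmonic.
move: y0; rewrite le_eqVlt => /predU1P[y0|y0].
  rewrite -y0 powR0 ?gt_eqF//.
  apply/cvgrPdist_le => e e0; near=> n.
  rewrite sub0r normrN add0r ger0_norm ?powR_ge0//.
  have en : n.+1%:R^-1 <= e `^ r^-1.
    near: n; have := @cvg_harmonic R => /cvgrPdist_le /(_ (e `^ r^-1)).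
    rewrite powR_gt0// => /(_ isT); apply: filterS => n /=.
    by rewrite sub0r normrN ger0_norm.
  rewrite [leRHS](_ : e = (e `^ r^-1) `^ r); last first.
    by rewrite -powRrM mulVf ?gt_eqF// powRr1// ltW.
  by apply: ge0_ler_powR => //; rewrite ?nnegrE ?powR_ge0//; exact: ltW.
have cont : {for y, continuous (fun z : R => z `^ r)}.
  apply: differentiable_continuous; apply/derivable1_diffP.
  by apply: derivable_powR; rewrite in_itv/= y0.
exact: (cvg_comp _ _ cvgy cont).
Unshelve. all: by end_near. Qed.

Lemma le_powR_mul_limit (x a b r : R) : 0 <= a -> 0 <= b -> 0 < r ->
  (forall n, x <= (a + n.+1%:R^-1) `^ r * (b + n.+1%:R^-1)) ->
  x <= a `^ r * b.
Proof.
move=> a0 b0 r0 xle.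
have cv : (a + n.+1%:R^-1) `^ r * (b + n.+1%:R^-1) @[n --> \oo] --> a `^ r * b.
  apply: cvgM; first exact: cvg_powR_inv_shift.
  rewrite -[X in _ --> X]addr0; apply: cvgD; first exact: cvg_cst.
  exact: cvg_harmonic.
by apply: (ler_cvg_to (cvg_cst x) cv); exact: nearW.
Qed.

(** Young's inequality for [a / s `^ q^-1] and [b / t `^ p^-1].  The right-hand
    side is linear in [a `^ q] and [b `^ p], so that its conditional expectation
    can be taken when [s] and [t] are replaced by functions measurable for the
    sub-sigma-algebra; [young_scaled_bound] then evaluates it. *)
Lemma young_scaled (a b s t p q : R) : 0 <= a -> 0 <= b -> 0 < s -> 0 < t ->
  0 < p -> 0 < q -> p^-1 + q^-1 = 1 ->
  a * b <= s `^ q^-1 * t `^ p^-1 / q * s `^ (-1) * a `^ q +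
           s `^ q^-1 * t `^ p^-1 / p * t `^ (-1) * b `^ p.
Proof.
move=> a0 b0 s0 t0 p0 q0 pq.
have al0 : 0 < s `^ q^-1 by exact: powR_gt0.
have be0 : 0 < t `^ p^-1 by exact: powR_gt0.
have := @conjugate_powR _ (a / s `^ q^-1) (b / t `^ p^-1) q p.
rewrite !divr_ge0 ?(ltW al0) ?(ltW be0)// addrC => /(_ isT isT q0 p0 pq).
have invE r c : 0 < c -> 0 < r -> (c `^ r^-1)^-1 `^ r = c^-1.
  by move=> c0 r0; rewrite -powRN -powRrM mulNr mulVf ?gt_eqF// powR_inv1 ?ltW.
rewrite !powRM ?invr_ge0 ?(ltW al0) ?(ltW be0)// !invE//.
rewrite !powR_inv1 ?(ltW s0) ?(ltW t0)//.
rewrite -(ler_pM2l (mulr_gt0 al0 be0)); set al := s `^ _; set be := t `^ _.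
have -> : al * be * (a * al^-1 * (b * be^-1)) = a * b.
  by field; rewrite !gt_eqF.
move=> /le_trans; apply.
by rewrite le_eqVlt; apply/orP; left; apply/eqP; field; rewrite !gt_eqF.
Qed.

Lemma young_scaled_bound (s t u f p q : R) :
  0 < s -> 0 < t -> u <= s -> f <= t -> 0 < p -> 0 < q -> p^-1 + q^-1 = 1 ->
  s `^ q^-1 * t `^ p^-1 / q * s `^ (-1) * u +
  s `^ q^-1 * t `^ p^-1 / p * t `^ (-1) * f <= s `^ q^-1 * t `^ p^-1.
Proof.
move=> s0 t0 us ft p0 q0 pq.
rewrite !powR_inv1 ?(ltW s0) ?(ltW t0)//; set k := s `^ _ * _.
have k0 : 0 <= k by rewrite mulr_ge0// powR_ge0.
have -> : k / q / s * u + k / p / t * f = k * (q^-1 * (u / s) + p^-1 * (f / t)).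
  by field; rewrite !gt_eqF.
rewrite -[X in _ <= X]mulr1 -pq [X in _ <= _ * X]addrC ler_wpM2l// lerD//.
  by rewrite ler_piMr ?invr_ge0 ?(ltW q0)// ler_pdivrMr// mul1r.
by rewrite ler_piMr ?invr_ge0 ?(ltW p0)// ler_pdivrMr// mul1r.
Qed.

(** Since [c] is finite, [a] and [b] can only be infinite together, and then
    [fine] sends both to 0. *)
Lemma abs_fine_diff_le (a b c : \bar R) :
  (0 <= a -> 0 <= b -> 0 <= c -> c < +oo -> a <= b + c -> b <= a + c ->
  `|fine a - fine b|%:E <= c)%E.
Proof.
move: c => [c| |]// a0 b0 c0 _.
case: a a0 => [a| |]//; case: b b0 => [b| |]// a0 b0; rewrite ?leey//=.
- by rewrite -!EFinD !lee_fin => ab ba; rewrite ler_norml lerBlDl lerBrDr; lra.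
- by move=> _ _; rewrite subrr normr0.
Qed.

Lemma poweR_le_mul_lty (x a b : \bar R) (r s : R) : (0 < r)%R ->
  (x `^ r <= a `^ s * b -> a < +oo -> b < +oo -> x < +oo)%E.
Proof.
move=> r0 + aoo boo; rewrite [(x < _)%E]ltey => xle; apply/eqP => xoo.
move: xle; rewrite xoo poweRyr ?gt_eqF// leNgt => /negP; apply.
apply: lte_mul_pinfty => //; first exact: poweR_ge0.
by rewrite ge0_fin_numE ?poweR_ge0//; exact: poweR_lty.
Qed.

End powR_limits.

Section condexp_inequalities.
Context {d : measure_display} {T : measurableType d} {R : realType}.
Variables (mu : {measure set T -> \bar R}) (A : set (set T)).
Hypothesis Asigma : sigma_algebra [set: T] A.
Hypothesis Asub : A `<=` @measurable d T.
Hypothesis Afin : sigma_finite [set: g_sigma_algebraType A] mu.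

Local Notation TA := (g_sigma_algebraType A).
Local Open Scope ereal_scope.

Let AmeasT := subalgebra_measurable_fun Asigma Asub.

Lemma condexp_pull_out (f g h : T -> \bar R) (B : set T) : A B ->
  measurable_fun [set: T] f -> (forall x, 0 <= f x) -> is_condexp mu A f g ->
  measurable_fun [set: TA] h -> (forall x, 0 <= h x) ->
  \int[mu]_(x in B) (h x * f x) = \int[mu]_(x in B) (h x * g x).
Proof.
move=> AB mf f0 [mg g0 gE] mh h0.
apply: (integral_mul_subalgebra Asigma Asub) => //; first exact: AmeasT.
by move=> C AC; rewrite gE.
Qed.

(** Conditional expectations preserve inequalities with coefficients measurable
    for the sub-sigma-algebra.  Constant coefficients give subadditivity, and
    those of [young_scaled] give Hoelder's inequality. *)
Lemma condexp_le_combination (f f1 f2 g g1 g2 h1 h2 : T -> \bar R) :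
  measurable_fun [set: T] f -> (forall x, 0 <= f x) -> is_condexp mu A f g ->
  measurable_fun [set: T] f1 -> (forall x, 0 <= f1 x) ->
    is_condexp mu A f1 g1 ->
  measurable_fun [set: T] f2 -> (forall x, 0 <= f2 x) ->
    is_condexp mu A f2 g2 ->
  measurable_fun [set: TA] h1 -> (forall x, 0 <= h1 x) ->
  measurable_fun [set: TA] h2 -> (forall x, 0 <= h2 x) ->
  (forall x, f x <= h1 x * f1 x + h2 x * f2 x) ->
  {ae mu, forall x, g x <= h1 x * g1 x + h2 x * g2 x}.
Proof.
move=> mf f0 gP mf1 f10 g1P mf2 f20 g2P mh1 h10 mh2 h20 fle.
have [mg g0 gE] := gP; have [mg1 g10 _] := g1P; have [mg2 g20 _] := g2P.
apply: (ae_le_subalgebra Asigma Asub Afin) => //.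
- by apply: emeasurable_funD; exact: emeasurable_funM.
- by move=> x; rewrite adde_ge0// mule_ge0.
move=> B AB; have mB : measurable B by exact: Asub.
have mh1T := AmeasT mh1; have mh2T := AmeasT mh2.
have mg1T := AmeasT mg1; have mg2T := AmeasT mg2.
rewrite gE// ge0_integralD//; last 4 first.
- by move=> x _; rewrite mule_ge0.
- by apply: measurable_funTS; exact: emeasurable_funM.
- by move=> x _; rewrite mule_ge0.
- by apply: measurable_funTS; exact: emeasurable_funM.
rewrite -(condexp_pull_out AB mf1 f10 g1P)// -(condexp_pull_out AB mf2 f20 g2P)//.
rewrite -ge0_integralD//; last 4 first.
- by move=> x _; rewrite mule_ge0.
- by apply: measurable_funTS; exact: emeasurable_funM.
- by move=> x _; rewrite mule_ge0.
- by apply: measurable_funTS; exact: emeasurable_funM.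
apply: ge0_le_integral => //.
- exact: measurable_funTS.
- by apply: measurable_funTS; apply: emeasurable_funD; exact: emeasurable_funM.
Qed.

Lemma condexp_le_add (f f1 f2 g g1 g2 : T -> \bar R) :
  measurable_fun [set: T] f -> (forall x, 0 <= f x) -> is_condexp mu A f g ->
  measurable_fun [set: T] f1 -> (forall x, 0 <= f1 x) ->
    is_condexp mu A f1 g1 ->
  measurable_fun [set: T] f2 -> (forall x, 0 <= f2 x) ->
    is_condexp mu A f2 g2 ->
  (forall x, f x <= f1 x + f2 x) -> {ae mu, forall x, g x <= g1 x + g2 x}.
Proof.
move=> mf f0 gP mf1 f10 g1P mf2 f20 g2P fle.
have m1 : measurable_fun [set: TA] (cst (1%:E : \bar R)) by exact: measurable_cst.
have p1 (x : T) : 0 <= cst (1%:E : \bar R) x by rewrite lee_fin.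
have le1 : {ae mu, forall x, g x <= cst 1%:E x * g1 x + cst 1%:E x * g2 x}.
  apply: (condexp_le_combination mf f0 gP mf1 f10 g1P mf2 f20 g2P) => // x.
  by rewrite /= !mul1e.
by apply: filterS le1 => x; rewrite /= !mul1e.
Qed.

Lemma condexp_mul (f g g' h : T -> \bar R) :
  measurable_fun [set: T] f -> (forall x, 0 <= f x) -> is_condexp mu A f g ->
  measurable_fun [set: TA] h -> (forall x, 0 <= h x) ->
  is_condexp mu A (fun x => h x * f x) g' ->
  {ae mu, forall x, g' x = h x * g x}.
Proof.
move=> mf f0 gP mh h0 [mg' g'0 g'E]; have [mg g0 _] := gP.
have mhg : measurable_fun [set: TA] (fun x => h x * g x) by exact: emeasurable_funM.
have hg0 x : 0 <= h x * g x by rewrite mule_ge0.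
have int_eq B : A B -> \int[mu]_(x in B) g' x = \int[mu]_(x in B) (h x * g x).
  by move=> AB; rewrite g'E// (condexp_pull_out AB mf f0 gP).
have le1 : {ae mu, forall x, g' x <= h x * g x}.
  by apply: (ae_le_subalgebra Asigma Asub Afin) => // B /int_eq ->.
have le2 : {ae mu, forall x, h x * g x <= g' x}.
  by apply: (ae_le_subalgebra Asigma Asub Afin) => // B /int_eq ->.
by apply: filterS2 le1 le2 => x ? ?; apply/eqP; rewrite eq_le; apply/andP.
Qed.

(** [young_scaled] with [s = U + e] and [t = F + e] gives the inequality up to
    [e].  The shift keeps [s] and [t] positive where [U] or [F] vanishes; [e]
    runs through a sequence, so the exceptional null sets stay countable in
    number, and is then sent to 0. *)
Lemma condexp_hoelder (a b : T -> R) (p q : R) (X U F : T -> \bar R) :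
  measurable_fun [set: T] a -> (forall x, 0 <= a x)%R ->
  measurable_fun [set: T] b -> (forall x, 0 <= b x)%R ->
  (1 < p)%R -> (1 < q)%R -> (p^-1 + q^-1 = 1)%R ->
  is_condexp mu A (fun x => (a x * b x)%:E) X ->
  is_condexp mu A (fun x => (a x `^ q)%:E) U ->
  is_condexp mu A (fun x => (b x `^ p)%:E) F ->
  {ae mu, forall x, U x < +oo} -> {ae mu, forall x, F x < +oo} ->
  {ae mu, forall x, X x `^ p <= U x `^ (p / q) * F x}.
Proof.
move=> ma a0 mb b0 p1 q1 pq XP UP FP Ufin Ffin.
have p0 : (0 < p)%R by lra. have q0 : (0 < q)%R by lra.
have [mX X0 _] := XP; have [mU U0 _] := UP; have [mF F0 _] := FP.
have maq : measurable_fun [set: T] (fun x => (a x `^ q)%:E).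
  by apply/measurable_EFinP; exact: measurable_fun_powR.
have mbp : measurable_fun [set: T] (fun x => (b x `^ p)%:E).
  by apply/measurable_EFinP; exact: measurable_fun_powR.
have mab : measurable_fun [set: T] (fun x => (a x * b x)%:E).
  by apply/measurable_EFinP; exact: measurable_funM.
have mfine (G : T -> \bar R) (e : R) : measurable_fun [set: TA] G ->
    measurable_fun [set: TA] (fun x => fine (G x) + e)%R.
  by move=> mG; apply: measurable_funD => //; exact: measurableT_comp.
have le_e n : {ae mu, forall x, X x `^ p <=
    ((fine (U x) + n.+1%:R^-1) `^ (p / q) * (fine (F x) + n.+1%:R^-1))%R%:E}.
  set e : R := n.+1%:R^-1%R; have e0 : (0 < e)%R by rewrite invr_gt0 ltr0n.
  pose U' x := (fine (U x) + e)%R; pose F' x := (fine (F x) + e)%R.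
  have U'0 x : (0 < U' x)%R by rewrite ltr_wpDl// fine_ge0.
  have F'0 x : (0 < F' x)%R by rewrite ltr_wpDl// fine_ge0.
  pose k x := (U' x `^ q^-1 * F' x `^ p^-1)%R.
  have mU' : measurable_fun [set: TA] U' by exact: mfine.
  have mF' : measurable_fun [set: TA] F' by exact: mfine.
  have mpow (G : T -> R) r : measurable_fun [set: TA] G ->
      measurable_fun [set: TA] (fun x => G x `^ r)%R.
    exact: measurable_fun_powR.
  have mk : measurable_fun [set: TA] k by apply: measurable_funM; exact: mpow.
  have mw r (G : T -> R) : measurable_fun [set: TA] G ->
      measurable_fun [set: TA] (fun x => (k x / r * G x `^ (-1))%:E).
    move=> mG; apply/measurable_EFinP; apply: measurable_funM; last exact: mpow.
    exact: measurable_funM.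
  have w0 r (G : T -> R) x : (0 < r)%R -> 0 <= (k x / r * G x `^ (-1))%:E.
    by move=> r0; rewrite lee_fin !mulr_ge0 ?powR_ge0 ?invr_ge0 ?(ltW r0).
  have Xle : {ae mu, forall x, X x <= (k x / q * U' x `^ (-1))%:E * U x +
      (k x / p * F' x `^ (-1))%:E * F x}.
    apply: (condexp_le_combination mab _ XP maq _ UP mbp _ FP (mw q U' mU')
      (fun x => w0 q U' x q0) (mw p F' mF') (fun x => w0 p F' x p0)) => x.
    - by rewrite lee_fin mulr_ge0.
    - by rewrite lee_fin powR_ge0.
    - by rewrite lee_fin powR_ge0.
    - by rewrite -!EFinM -EFinD lee_fin; exact: young_scaled.
  apply: filterS3 Xle Ufin Ffin => x Xle Ux Fx.
  have UE : U x = (fine (U x))%:E by rewrite fineK// ge0_fin_numE.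
  have FE : F x = (fine (F x))%:E by rewrite fineK// ge0_fin_numE.
  have {}Xle : X x <= (k x)%:E.
    apply: le_trans Xle _; rewrite UE FE -!EFinM -EFinD lee_fin.
    by apply: young_scaled_bound => //; rewrite lerDl ltW.
  have -> : ((fine (U x) + e) `^ (p / q) * (fine (F x) + e))%R = (k x `^ p)%R.
    rewrite /k powRM ?powR_ge0// -!powRrM mulVf ?gt_eqF// powRr1 ?(ltW (F'0 x))//.
    by rewrite [(q^-1 * p)%R]mulrC.
  rewrite -poweR_EFin; apply: gt0_ler_poweR => //; first exact: ltW.
    by rewrite in_itv/= X0 leey.
  by rewrite in_itv/= leey andbT lee_fin mulr_ge0// powR_ge0.
have := ae_foralln le_e.
apply: filterS3 Ufin Ffin => x Ux Fx Xle.
have UE : U x = (fine (U x))%:E by rewrite fineK// ge0_fin_numE.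
have FE : F x = (fine (F x))%:E by rewrite fineK// ge0_fin_numE.
have Xfin : X x `^ p \is a fin_num.
  by rewrite ge0_fin_numE ?poweR_ge0// (le_lt_trans (Xle 0%N))// ltry.
rewrite UE FE poweR_EFin -EFinM -(fineK Xfin) lee_fin.
apply: le_powR_mul_limit; rewrite ?fine_ge0 ?divr_gt0// => n.
by rewrite -lee_fin fineK.
Qed.

End condexp_inequalities.

(** * Complex-valued functions *)

Section complex_functions.
Context {d : measure_display} {T : measurableType d} {R : realType}.
Implicit Types f g : T -> R[i].

Lemma modulusE (z : R[i]) :
  modulus z = Num.sqrt (complex.Re z ^+ 2 + complex.Im z ^+ 2).
Proof. by case: z. Qed.

Lemma modulus_ge0 (z : R[i]) : 0 <= modulus z.
Proof. by rewrite modulusE sqrtr_ge0. Qed.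

Lemma modulusM (y z : R[i]) : modulus (y * z) = modulus y * modulus z.
Proof. exact: ComplexField.Normc.normcM. Qed.

Lemma sqr_modulus (z : R[i]) :
  modulus z ^+ 2 = complex.Re z ^+ 2 + complex.Im z ^+ 2.
Proof. by rewrite modulusE sqr_sqrtr// addr_ge0// sqr_ge0. Qed.

Lemma modulus_real (x : R) : modulus (x%:C)%C = `|x|.
Proof. by rewrite modulusE/= expr0n addr0 sqrtr_sqr. Qed.

Lemma normr_Re_le (z : R[i]) : `|complex.Re z| <= modulus z.
Proof. by rewrite modulusE -sqrtr_sqr ler_sqrt ?lerDl ?addr_ge0 ?sqr_ge0. Qed.

Lemma normr_Im_le (z : R[i]) : `|complex.Im z| <= modulus z.
Proof. by rewrite modulusE -sqrtr_sqr ler_sqrt ?lerDr ?addr_ge0 ?sqr_ge0. Qed.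

Lemma modulus_le_ReIm (z : R[i]) :
  modulus z <= `|complex.Re z| + `|complex.Im z|.
Proof.
have s0 : 0 <= `|complex.Re z| + `|complex.Im z| by rewrite addr_ge0.
rewrite modulusE -[leRHS](ger0_norm s0) -sqrtr_sqr ler_sqrt ?sqr_ge0//.
rewrite -[complex.Re z ^+ 2]real_normK ?num_real//.
rewrite -[complex.Im z ^+ 2]real_normK ?num_real//.
by rewrite sqrrD lerD2r lerDl mulrn_wge0// mulr_ge0.
Qed.

Lemma measurable_modulus f : cmeasurable f ->
  measurable_fun [set: T] (fun x => modulus (f x)).
Proof.
move=> [mRe mIm].
rewrite (_ : (fun x => _) = fun x =>
    (complex.Re (f x) ^+ 2 + complex.Im (f x) ^+ 2) `^ 2^-1); last first.
  by apply/funext => x; rewrite modulusE powR12_sqrt// addr_ge0 ?sqr_ge0.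
apply: measurable_fun_powR; apply: measurable_funD; exact: measurable_funX.
Qed.

Lemma measurable_modulus_powR (r : R) f : cmeasurable f ->
  measurable_fun [set: T] (fun x => (modulus (f x) `^ r)%:E)%E.
Proof.
move=> mf; apply/measurable_EFinP; apply: measurable_fun_powR.
exact: measurable_modulus.
Qed.

Lemma modulus_powR_ge0 (r : R) (z : R[i]) : (0 <= (modulus z `^ r)%:E)%E.
Proof. by rewrite lee_fin powR_ge0. Qed.

Lemma cmeasurableM f g : cmeasurable f -> cmeasurable g ->
  cmeasurable (fun x => f x * g x).
Proof.
move=> [mRf mIf] [mRg mIg]; split.
  rewrite (_ : (fun x => _) = fun x => complex.Re (f x) * complex.Re (g x) -
      complex.Im (f x) * complex.Im (g x)); last first.
    by apply/funext => x; case: (f x) (g x) => ? ? [].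
  by apply: measurable_funB; exact: measurable_funM.
rewrite (_ : (fun x => _) = fun x => complex.Re (f x) * complex.Im (g x) +
    complex.Im (f x) * complex.Re (g x)); last first.
  by apply/funext => x; case: (f x) (g x) => ? ? [].
by apply: measurable_funD; exact: measurable_funM.
Qed.

Lemma cmeasurableB f g : cmeasurable f -> cmeasurable g ->
  cmeasurable (fun x => f x - g x).
Proof.
move=> [mRf mIf] [mRg mIg]; split.
  rewrite (_ : (fun x => _) = fun x => complex.Re (f x) - complex.Re (g x));
    last by apply/funext => x; case: (f x) (g x) => ? ? [].
  exact: measurable_funB.
rewrite (_ : (fun x => _) = fun x => complex.Im (f x) - complex.Im (g x));
  last by apply/funext => x; case: (f x) (g x) => ? ? [].
exact: measurable_funB.
Qed.

Lemma cmeasurable0 : cmeasurable (fun _ : T => 0 : R[i]).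
Proof. by split; exact: measurable_cst. Qed.

End complex_functions.

Section complex_Lp.
Context {d : measure_display} {T : measurableType d} {R : realType}.
Variables (mu : {measure set T -> \bar R}) (p : R).
Hypothesis p0 : 0 < p.
Local Open Scope ereal_scope.

(** The p-th power of the norm, for which integrals need no outer power. *)
Definition Lp_energy (f : T -> R[i]) : \bar R :=
  \int[mu]_x (modulus (f x) `^ p)%:E.

Lemma Lp_energy_ge0 f : 0 <= Lp_energy f.
Proof. by apply: integral_ge0 => x _; rewrite lee_fin powR_ge0. Qed.

Lemma cLnormE f : cLnorm mu p f = Lp_energy f `^ p^-1.
Proof.
rewrite /cLnorm unlock; congr (_ `^ _); apply: eq_integral => x _.
by rewrite /= ger0_norm// modulus_ge0.
Qed.

Lemma cLnorm_poweR f : cLnorm mu p f `^ p = Lp_energy f.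
Proof.
by rewrite cLnormE -poweRrM mulVf ?gt_eqF// poweRe1// Lp_energy_ge0.
Qed.

Lemma cLnorm_lty f : (cLnorm mu p f < +oo) = (Lp_energy f < +oo).
Proof.
apply/idP/idP; first by rewrite -cLnorm_poweR; exact: poweR_lty.
by rewrite cLnormE; exact: poweR_lty.
Qed.

Lemma cLnorm_lt f (r : R) : (0 < r)%R ->
  (cLnorm mu p f < r%:E) = (Lp_energy f < (r `^ p)%:E).
Proof.
move=> r0; have N0 : 0 <= cLnorm mu p f by rewrite cLnormE poweR_ge0.
have [ltoo|geoo] := ltP (cLnorm mu p f) +oo; last first.
  have := geoo; rewrite -cLnorm_poweR leye_eq => /eqP ->.
  by rewrite poweRyr ?gt_eqF.
rewrite -cLnorm_poweR; move: N0 ltoo; case: (cLnorm _ _ _) => [n| |]//= n0 _.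
rewrite !lte_fin; apply/idP/idP => [nr|].
  by apply: (gt0_ltr_powR p0) => //; rewrite nnegrE ltW.
apply: contraTT; rewrite -!leNgt => rn.
by apply: (ge0_ler_powR (ltW p0)) => //; rewrite nnegrE ltW.
Qed.

End complex_Lp.

Lemma ler_norm_max0B {R : realDomainType} (a b : R) :
  `|Num.max a 0 - Num.max b 0| <= `|a - b|.
Proof.
have := ler_norm (a - b); have := ler_norm (b - a); rewrite (distrC b a).
rewrite !maxEle ler_norml; case: ifPn; case: ifPn; rewrite -?ltNge => *;
  by apply/andP; split; lra.
Qed.

Section condexp_complex.
Context {d : measure_display} {T : measurableType d} {R : realType}.
Variables (mu : {measure set T -> \bar R}) (A : set (set T)).
Hypothesis Asigma : sigma_algebra [set: T] A.
Hypothesis Asub : A `<=` @measurable d T.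
Hypothesis Afin : sigma_finite [set: g_sigma_algebraType A] mu.

Local Notation TA := (g_sigma_algebraType A).

Let AmeasT := subalgebra_measurable_fun Asigma Asub.

(** By [f <= g + e] and [g <= f + e], the conditional expectations of [f] and [g]
    are infinite on the same set up to a null set, and there [fine] makes their
    difference vanish. *)
Lemma condexp_ge0B_le (f g e : T -> R) (X : T -> \bar R) :
  measurable_fun [set: T] f -> (forall x, 0 <= f x) ->
  measurable_fun [set: T] g -> (forall x, 0 <= g x) ->
  measurable_fun [set: T] e -> (forall x, `|f x - g x| <= e x) ->
  is_condexp mu A (EFin \o e) X -> {ae mu, forall x, (X x < +oo)%E} ->
  {ae mu, forall x, (`|fine (condexp_ge0 mu A (EFin \o f) x) -
                       fine (condexp_ge0 mu A (EFin \o g) x)|%:E <= X x)%E}.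
Proof.
move=> mf f0 mg g0 me fge XP Xfin; have [mX X0 _] := XP.
have e0 x : 0 <= e x by exact: le_trans (fge x).
have fP := condexpP Asigma Asub Afin mf f0.
have gP := condexpP Asigma Asub Afin mg g0.
have [_ Ef0 _] := fP; have [_ Eg0 _] := gP.
move/measurable_EFinP : mf => mf; move/measurable_EFinP : mg => mg.
move/measurable_EFinP : me => me.
have ge0 (h : T -> R) : (forall x, 0 <= h x) -> forall x, (0 <= (EFin \o h) x)%E.
  by move=> h0 x; rewrite lee_fin.
have fle : {ae mu, forall x, (condexp_ge0 mu A (EFin \o f) x <=
    condexp_ge0 mu A (EFin \o g) x + X x)%E}.
  apply: (condexp_le_add Asigma Asub Afin mf (ge0 _ f0) fP mg (ge0 _ g0) gP
    me (ge0 _ e0) XP) => x.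
  rewrite -EFinD lee_fin -lerBlDl; exact: le_trans (ler_norm _) (fge x).
have gle : {ae mu, forall x, (condexp_ge0 mu A (EFin \o g) x <=
    condexp_ge0 mu A (EFin \o f) x + X x)%E}.
  apply: (condexp_le_add Asigma Asub Afin mg (ge0 _ g0) gP mf (ge0 _ f0) fP
    me (ge0 _ e0) XP) => x.
  rewrite -EFinD lee_fin -lerBlDl; apply: le_trans (ler_norm _) _.
  by rewrite distrC.
by apply: filterS3 fle gle Xfin => x fx gx Xx; exact: abs_fine_diff_le.
Qed.

Lemma condexp_realB_le (f g e : T -> R) (X : T -> \bar R) :
  measurable_fun [set: T] f -> measurable_fun [set: T] g ->
  measurable_fun [set: T] e -> (forall x, `|f x - g x| <= e x) ->
  is_condexp mu A (EFin \o e) X -> {ae mu, forall x, (X x < +oo)%E} ->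
  {ae mu, forall x, (`|condexp_real mu A f x - condexp_real mu A g x|%:E <=
    2%:E * X x)%E}.
Proof.
move=> mf mg me fge XP Xfin.
have pos : {ae mu, forall x, (`|fine (condexp_ge0 mu A (EFin \o f^\+) x) -
    fine (condexp_ge0 mu A (EFin \o g^\+) x)|%:E <= X x)%E}.
  apply: (condexp_ge0B_le (measurable_funrpos mf) (funrpos_ge0 f)
    (measurable_funrpos mg) (funrpos_ge0 g) me _ XP Xfin) => x.
  exact: le_trans (ler_norm_max0B _ _) (fge x).
have neg : {ae mu, forall x, (`|fine (condexp_ge0 mu A (EFin \o f^\-) x) -
    fine (condexp_ge0 mu A (EFin \o g^\-) x)|%:E <= X x)%E}.
  apply: (condexp_ge0B_le (measurable_funrneg mf) (funrneg_ge0 f)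
    (measurable_funrneg mg) (funrneg_ge0 g) me _ XP Xfin) => x.
  apply: le_trans (ler_norm_max0B _ _) _.
  by rewrite opprK addrC distrC.
have [_ X0 _] := XP.
apply: filterS3 pos neg Xfin => x px nx Xx.
have XE : X x = (fine (X x))%:E by rewrite fineK// ge0_fin_numE.
move: px nx; rewrite /condexp_real XE -EFinM !lee_fin.
rewrite mulr_natl mulr2n opprD addrACA -opprD => px nx.
exact: le_trans (ler_normB _ _) (lerD px nx).
Qed.

(** The constant 4 counts the positive and negative parts of the real and
    imaginary parts; its value does not matter for continuity. *)
Lemma condexpB_le (f g : T -> R[i]) (X : T -> \bar R) :
  cmeasurable f -> cmeasurable g ->
  is_condexp mu A (fun x => (modulus (f x - g x))%:E) X ->
  {ae mu, forall x, (X x < +oo)%E} ->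
  {ae mu, forall x,
    ((modulus (condexp mu A f x - condexp mu A g x))%:E <= 4%:E * X x)%E}.
Proof.
move=> cf cg XP Xfin; have [_ X0 _] := XP.
have me : measurable_fun [set: T] (fun x => modulus (f x - g x)).
  by apply: measurable_modulus; exact: cmeasurableB.
have [[mRf mIf] [mRg mIg]] := (cf, cg).
have re := @condexp_realB_le _ _ _ X mRf mRg me _ XP Xfin.
have im := @condexp_realB_le _ _ _ X mIf mIg me _ XP Xfin.
apply: filterS3 (re _) (im _) Xfin.
- move=> x rx ix Xx; have XE : X x = (fine (X x))%:E by rewrite fineK// ge0_fin_numE.
  move: rx ix; rewrite XE -!EFinM !lee_fin => rx ix.
  apply: le_trans (modulus_le_ReIm _) _.
  by rewrite (natrD _ 2 2) mulrDl; exact: lerD rx ix.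
- move=> x; apply: le_trans (normr_Re_le _).
  by case: (f x) (g x) => ? ? [].
- move=> x; apply: le_trans (normr_Im_le _).
  by case: (f x) (g x) => ? ? [].
Qed.

Lemma condexp_cmeasurable (f : T -> R[i]) : cmeasurable f ->
  cmeasurable (condexp mu A f).
Proof.
have real (h : T -> R) : measurable_fun [set: T] h ->
    measurable_fun [set: T] (condexp_real mu A h).
  move=> mh.
  have [mp _ _] := condexpP Asigma Asub Afin (measurable_funrpos mh) (funrpos_ge0 h).
  have [mn _ _] := condexpP Asigma Asub Afin (measurable_funrneg mh) (funrneg_ge0 h).
  apply: measurable_funB; (apply: measurableT_comp; first exact: fine_measurable).
    exact: AmeasT.
  exact: AmeasT.
by move=> [mR mI]; split; exact: real.
Qed.

End condexp_complex.

(** * Weights where the symbol is large *)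

Lemma ae_lty_integral {d : measure_display} {T : measurableType d}
    {R : realType} (mu : {measure set T -> \bar R}) (f : T -> \bar R) :
  measurable_fun [set: T] f -> (forall x, 0 <= f x)%E ->
  (\int[mu]_x f x < +oo)%E -> {ae mu, forall x, (f x < +oo)%E}.
Proof.
move=> mf f0 ifin.
have : mu.-integrable [set: T] f.
  by apply/integrableP; split => //; under eq_integral do rewrite gee0_abs//.
move=> /(integrable_ae measurableT); apply: filterS => x /(_ I).
by rewrite ge0_fin_numE.
Qed.

Section unbounded_symbol.
Context {d : measure_display} {T : measurableType d} {R : realType}.
Variables (mu : {measure set T -> \bar R}) (A : set (set T)).
Hypothesis Asigma : sigma_algebra [set: T] A.
Hypothesis Asub : A `<=` @measurable d T.
Hypothesis Afin : sigma_finite [set: g_sigma_algebraType A] mu.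

Local Notation TA := (g_sigma_algebraType A).
Local Open Scope ereal_scope.

Let AmeasT := subalgebra_measurable_fun Asigma Asub.

Lemma integral_bounded_lty (B : set T) (f : T -> \bar R) (M : R) :
  measurable B -> mu B < +oo -> measurable_fun B f -> (forall x, 0 <= f x) ->
  (0 <= M)%R -> (forall x, B x -> f x <= M%:E) -> \int[mu]_(x in B) f x < +oo.
Proof.
move=> mB Bfin mf f0 M0 fM.
apply: (@le_lt_trans _ _ (\int[mu]_(x in B) cst M%:E x)).
  exact: ge0_le_integral.
by rewrite integral_cst// lte_mul_pinfty.
Qed.

Lemma integral_scaled_indic (B : set T) (a : R) (f : T -> \bar R) :
  measurable B -> (0 <= a)%R ->
  measurable_fun [set: T] f -> (forall x, 0 <= f x) ->
  \int[mu]_x ((a * \1_B x)%:E * f x) = a%:E * \int[mu]_(x in B) f x.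
Proof.
move=> mB a0 mf f0; rewrite [in RHS]integral_mkcond epatch_indic.
rewrite -ge0_integralZl_EFin//; last 2 first.
- by move=> x _; rewrite mule_ge0// lee_fin.
- by apply: emeasurable_funM => //; exact/measurable_EFinP.
by apply: eq_integral => x _; rewrite EFinM -muleA [X in _ = _ * X]muleC.
Qed.

Variables (U J : T -> \bar R).
Hypotheses (mU : measurable_fun [set: TA] U) (U0 : forall x, 0 <= U x).
Hypotheses (mJ : measurable_fun [set: TA] J) (J0 : forall x, 0 <= J x).
Hypothesis UJ0 : forall x, U x = 0 -> J x = 0.
Hypothesis Ufin : {ae mu, forall x, U x < +oo}.
Hypothesis Jfin : {ae mu, forall x, J x < +oo}.

(** The set [{J > C}] has positive measure by assumption; up to a null set it is
    the union of its parts of finite measure on which [U] and [J] are bounded,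
    so one of these has positive measure.  The integral of [U] over it is
    positive because [U] vanishes only where [J] does. *)
Lemma large_symbol_set (C : R) : (0 <= C)%R ->
  ~ {ae mu, forall x, J x <= C%:E} ->
  exists B, [/\ A B, (forall x, B x -> C%:E < J x),
    0 < \int[mu]_(x in B) U x, \int[mu]_(x in B) U x < +oo &
    \int[mu]_(x in B) (J x * U x) < +oo].
Proof.
move=> C0 unb; have [F TF /all_and2[mF Ffin]] := Afin.
pose B n m : set T := (F m : set T) `&` [set x | C%:E < J x] `&`
  [set x | J x <= n%:R%:E] `&` [set x | U x <= n%:R%:E].
have mB n m : @measurable _ TA (B n m).
  apply: measurableI; last first.
    by rewrite -[X in measurable X]setTI; exact: emeasurable_fun_infty_c.
  apply: measurableI; last first.
    by rewrite -[X in measurable X]setTI; exact: emeasurable_fun_infty_c.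
  apply: measurableI => //.
  by rewrite -[X in measurable X]setTI; exact: emeasurable_fun_o_infty.
have mBT n m : measurable (B n m) by exact: (subalgebra_measurable Asigma Asub).
have [n [m Bpos]] : exists n m, mu (B n m) != 0.
  apply: contrapT => no; apply: unb.
  have B0 n m : mu.-negligible (B n m).
    apply/negligibleP => //; apply: contrapT => /eqP Bnm.
    by apply: no; exists n, m.
  have UB : mu.-negligible (\bigcup_n \bigcup_m B n m).
    by apply: negligible_bigcup => n; exact: negligible_bigcup.
  apply: (@negligibleS _ _ _ _ (\bigcup_n \bigcup_m B n m `|`
    (~` [set x | U x < +oo] `|` ~` [set x | J x < +oo]))); last first.
    by apply: negligibleU => //; exact: negligibleU.
  move=> x /= /negP; rewrite -ltNge => CJ.
  have [Ux|Ux] := pselect (U x < +oo); last by right; left.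
  have [Jx|Jx] := pselect (J x < +oo); last by right; right.
  left; have : [set: T] x by []. rewrite TF => -[m _ Fmx].
  have UE : U x = (fine (U x))%:E by rewrite fineK// ge0_fin_numE.
  have JE : J x = (fine (J x))%:E by rewrite fineK// ge0_fin_numE.
  have /archi_boundP/ltW : (0 <= fine (U x) + fine (J x))%R.
    by rewrite addr_ge0// fine_ge0.
  set n := Num.bound _ => UJn.
  exists n => //; exists m => //; split; [split; [split|]|] => //=.
    by rewrite JE lee_fin (le_trans _ UJn)// lerDr fine_ge0.
  by rewrite UE lee_fin (le_trans _ UJn)// lerDl fine_ge0.
have Bfin : mu (B n m) < +oo.
  apply: le_lt_trans (Ffin m); apply: le_measure => //; rewrite ?inE//.
    exact: (subalgebra_measurable Asigma Asub).
  by move=> x [[[]]].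
have mUB : measurable_fun (B n m) U by apply: measurable_funTS; exact: AmeasT.
exists (B n m); split.
- exact: (measurable_in_subalgebra Asigma).
- by move=> x [[[]]].
- rewrite lt0e integral_ge0// andbT; apply: contra Bpos => /eqP intU0.
  have /(ae_eq_integral_abs mu (mBT n m) mUB) :
      \int[mu]_(x in B n m) `|U x| = 0.
    by rewrite -intU0; apply: eq_integral => x _; rewrite gee0_abs.
  move=> /(negligibleS _)/(negligibleP _ (mBT n m)) -> // x Bx /= /(_ Bx) /UJ0 Jx0.
  by case: Bx => -[[_ /=]]; rewrite Jx0 lte_fin ltNge C0.
- apply: (@integral_bounded_lty _ _ n%:R) => //.
  by move=> x [].
- apply: (@integral_bounded_lty _ _ (n%:R * n%:R)%R) => //.
  + by apply: measurable_funTS; apply: AmeasT; exact: emeasurable_funM.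
  + by move=> x; rewrite mule_ge0.
  + by move=> x [[_ Jn] Un]; rewrite EFinM; exact: lee_pmul.
Qed.

(** A multiple of the indicator of a set where [J > C]. *)
Lemma concentrated_weight (C s : R) : (0 <= C)%R -> (0 < s)%R ->
  ~ {ae mu, forall x, J x <= C%:E} ->
  exists k : T -> R, [/\ measurable_fun [set: TA] k, (forall x, 0 <= k x)%R,
    \int[mu]_x ((k x)%:E * U x) = s%:E,
    (C * s)%:E <= \int[mu]_x ((k x)%:E * (J x * U x)) &
    \int[mu]_x ((k x)%:E * (J x * U x)) < +oo].
Proof.
move=> C0 s0 /(large_symbol_set C0)[B [AB CJ IU0 IUoo IJUoo]].
have mB : measurable B by exact: Asub.
have mUT := AmeasT mU; have mJT := AmeasT mJ.
have mJU : measurable_fun [set: T] (fun x => J x * U x) by exact: emeasurable_funM.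
have JU0 x : 0 <= J x * U x by rewrite mule_ge0.
have [I IE] : exists I : R, \int[mu]_(x in B) U x = I%:E.
  by exists (fine (\int[mu]_(x in B) U x)); rewrite fineK// ge0_fin_numE// ltW.
have I0 : (0 < I)%R by rewrite -lte_fin -IE.
have sI0 : (0 <= s / I)%R by rewrite divr_ge0 ?(ltW s0) ?(ltW I0).
exists (fun x => s / I * \1_B x)%R; split.
- apply: measurable_funM => //; apply: measurable_indic.
  by rewrite subalgebra_measurableE.
- by move=> x; rewrite mulr_ge0.
- by rewrite integral_scaled_indic// IE -EFinM divfK// gt_eqF.
- rewrite integral_scaled_indic//.
  have -> : (C * s = s / I * (C * I))%R by field; rewrite gt_eqF.
  rewrite EFinM lee_wpmul2l ?lee_fin// EFinM -IE -ge0_integralZl_EFin//; last first.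
    exact: measurable_funTS.
  apply: ge0_le_integral => //.
  + by move=> x _; rewrite mule_ge0// lee_fin.
  + by apply: measurable_funTS; exact: emeasurable_funM.
  + exact: measurable_funTS.
  + by move=> x Bx; rewrite lee_wpmul2r// ltW// CJ.
- rewrite integral_scaled_indic// lte_mul_pinfty ?lee_fin//.
Qed.

(** A sum of concentrated weights with respective masses [s n], summable, and
    levels [C n] such that [C n * s n = n]. *)
Lemma resonant_weight :
  (forall C, (0 <= C)%R -> ~ {ae mu, forall x, J x <= C%:E}) ->
  exists k : T -> R, [/\ measurable_fun [set: TA] k, (forall x, 0 <= k x)%R,
    \int[mu]_x ((k x)%:E * U x) < +oo &
    \int[mu]_x ((k x)%:E * (J x * U x)) = +oo].
Proof.
move=> unb; have mUT := AmeasT mU; have mJT := AmeasT mJ.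
have mJU : measurable_fun [set: T] (fun x => J x * U x) by exact: emeasurable_funM.
have JU0 x : 0 <= J x * U x by rewrite mule_ge0.
pose s n : R := (1 / (2 ^ n.+1)%:R)%R.
have s0 n : (0 < s n)%R by rewrite divr_gt0// ltr0n expn_gt0.
pose C n : R := (n%:R / s n)%R.
have C0 n : (0 <= C n)%R by rewrite divr_ge0// ltW.
have [k kP] := choice (fun n => concentrated_weight (C0 n) (s0 n) (unb _ (C0 n))).
have [mk k0 kU kJU _] := all_and5 kP.
pose K x := \sum_(n <oo) (k n x)%:E.
have mK : measurable_fun [set: TA] K.
  have mkE n : measurable_fun [set: TA] (fun x => (k n x)%:E).
    exact/measurable_EFinP.
  by apply: (@ge0_emeasurable_sum _ TA) => // n x _ _; rewrite lee_fin.
have K0 x : 0 <= K x by apply: nneseries_ge0 => n _ _; rewrite lee_fin.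
pose S x := \sum_(n <oo) ((k n x)%:E * U x).
have mkU n : measurable_fun [set: T] (fun x => (k n x)%:E * U x).
  by apply: AmeasT; apply: emeasurable_funM => //; exact/measurable_EFinP.
have kU0 n x : 0 <= (k n x)%:E * U x by rewrite mule_ge0// lee_fin.
have mS : measurable_fun [set: T] S by exact: ge0_emeasurable_sum.
have S0 x : 0 <= S x by exact: nneseries_ge0.
have intS : \int[mu]_x S x < +oo.
  rewrite integral_nneseries//; under eq_eseriesr do rewrite kU.
  by apply: le_lt_trans (epsilon_trick0 _ _) (ltry 1).
have Sfin := ae_lty_integral mS S0 intS.
(* [K] may be infinite where [U] vanishes, so it is truncated by [fine]; this
   changes [K * U] on a null set only. *)
have kUS : {ae mu, forall x, (fine (K x))%:E * U x = S x}.
  apply: filterS2 Ufin Sfin => x Ux Sx.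
  have UE : U x = (fine (U x))%:E by rewrite fineK// ge0_fin_numE.
  have SE : S x = K x * U x.
    rewrite /S UE; under eq_eseriesr do rewrite muleC.
    rewrite nneseriesZl; last by move=> n _; rewrite lee_fin.
    exact: muleC.
  have [U_eq0|U_neq0] := eqVneq (U x) 0; first by rewrite SE U_eq0 !mule0.
  rewrite SE fineK// ge0_fin_numE// ltey; apply/eqP => Koo.
  by move: Sx; rewrite SE Koo gt0_mulye// lt0e U_neq0 U0.
exists (fine \o K); split.
- exact: measurableT_comp.
- by move=> x; rewrite fine_ge0.
- rewrite (ge0_ae_eq_integral (g := S))//.
  + by apply: AmeasT; apply: emeasurable_funM => //; apply/measurable_EFinP;
      exact: measurableT_comp.
  + by move=> x _; rewrite mule_ge0// lee_fin fine_ge0.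
  + by apply: filterS kUS => x.
set I := \int[mu]_x _.
have mI : measurable_fun [set: T] (fun x => ((fine \o K) x)%:E * (J x * U x)).
  apply: emeasurable_funM => //; apply/measurable_EFinP; apply: AmeasT.
  exact: measurableT_comp.
have I_ge n : n%:R%:E <= I.
  apply: (@le_trans _ _ (\int[mu]_x ((k n x)%:E * (J x * U x)))).
    by apply: le_trans (kJU n); rewrite /C divfK// gt_eqF.
  apply: ae_ge0_le_integral => //.
  - by move=> x _; rewrite mule_ge0// lee_fin.
  - by apply: emeasurable_funM => //; apply/measurable_EFinP; exact: AmeasT.
  - by move=> x _; rewrite mule_ge0// lee_fin fine_ge0.
  apply: filterS kUS => x kUSx _.
  rewrite muleCA [leRHS]muleCA lee_wpmul2l// kUSx.
  rewrite /S (nneseriesD1 (n := n))//.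
  by rewrite leeDl// nneseries_ge0.
have I0 : 0 <= I by apply: le_trans (I_ge 0%N).
apply/eqP; rewrite eq_le leey/= leNgt; apply/negP => Ioo.
have IE : I = (fine I)%:E by rewrite fineK// ge0_fin_numE.
have := archi_boundP (fine_ge0 I0); rewrite ltNge => /negP; apply.
by rewrite -lee_fin -IE.
Qed.

End unbounded_symbol.

(** * The weighted conditional type operator *)

Section wct_operator.
Context {d : measure_display} {T : measurableType d} {R : realType}.
Variables (mu : {measure set T -> \bar R}) (A : set (set T)).
Hypothesis Asigma : sigma_algebra [set: T] A.
Hypothesis Asub : A `<=` @measurable d T.
Hypothesis Afin : sigma_finite [set: g_sigma_algebraType A] mu.
Variables (u w : T -> R[i]).
Hypotheses (cu : cmeasurable u) (cw : cmeasurable w).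
Variables (p q : R).
Hypotheses (p1 : 1 < p) (q1 : 1 < q) (pq : p^-1 + q^-1 = 1).

Local Notation TA := (g_sigma_algebraType A).

Let AmeasT := subalgebra_measurable_fun Asigma Asub.
Let p0 : 0 < p. Proof. exact: lt_trans ltr01 p1. Qed.
Let q0 : 0 < q. Proof. exact: lt_trans ltr01 q1. Qed.

(** The equality case of Hoelder's inequality for the product with [u]. *)
Definition aligned (h : T -> R) (x : T) : R[i] :=
  ((h x * modulus (u x) `^ (q - 2))%:C * (u x)^*)%C.

Lemma mul_aligned (h : T -> R) x :
  u x * aligned h x = ((h x * modulus (u x) `^ q)%:C)%C.
Proof.
have -> : modulus (u x) `^ q = modulus (u x) ^+ 2 * modulus (u x) `^ (q - 2).
  rewrite -powR_mulrn ?modulus_ge0//.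
  have [->|m0] := eqVneq (modulus (u x)) 0.
    by rewrite (powR0 (lt0r_neq0 q0)) powR0 ?mul0r// pnatr_eq0.
  by rewrite -powRD ?m0 ?implybT// addrC subrK.
rewrite /aligned sqr_modulus; move: (modulus _ `^ _) => m.
case: (u x) => a b; apply/eqP; rewrite eq_complex /=; apply/andP.
by split; apply/eqP; ring.
Qed.

Lemma modulus_aligned (h : T -> R) x : 0 <= h x ->
  modulus (aligned h x) `^ p = h x `^ p * modulus (u x) `^ q.
Proof.
move=> h0; have mc : modulus ((u x)^*)%C = modulus (u x).
  by rewrite !modulusE; case: (u x) => a b /=; rewrite sqrrN.
rewrite /aligned modulusM modulus_real mc ger0_norm ?mulr_ge0 ?powR_ge0//.
have -> : h x * modulus (u x) `^ (q - 2) * modulus (u x) =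
    h x * modulus (u x) `^ (q - 1).
  rewrite -mulrA; congr (_ * _); rewrite mulrC.
  rewrite (_ : q - 2 = (q - 1) - 1); last by lra.
  by rewrite mulr_powRB1 ?modulus_ge0// subr_gt0.
rewrite powRM ?powR_ge0//; congr (_ * _); rewrite -powRrM; congr (_ `^ _).
have : p + q = p * q.
  have := congr1 ( *%R (p * q)) pq; rewrite mulr1 => <-; field.
  by rewrite !gt_eqF.
by move=> pqE; rewrite mulrBl mul1r mulrC -pqE addrAC subrr add0r.
Qed.

Lemma measurable_aligned (h : T -> R) : measurable_fun [set: T] h ->
  cmeasurable (aligned h).
Proof.
move=> mh; have [mRe mIm] := cu; apply: cmeasurableM; split => //=.
- apply: measurable_funM => //; apply: measurable_fun_powR.
  exact: measurable_modulus.
- by rewrite (_ : (fun x => _) = fun x => complex.Re (u x))//;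
    apply/funext => x; case: (u x).
- rewrite (_ : (fun x => _) = fun x => - complex.Im (u x)).
    exact: measurable_funN.
  by apply/funext => x; case: (u x).
Qed.

Local Open Scope ereal_scope.

Local Notation energy := (Lp_energy mu p).

Variables (U W : T -> \bar R).
Hypothesis UP : is_condexp mu A (fun x => (modulus (u x) `^ q)%:E) U.
Hypothesis WP : is_condexp mu A (fun x => (modulus (w x) `^ p)%:E) W.
Hypothesis Ufin : {ae mu, forall x, U x < +oo}.

Lemma measurable_wct (f : T -> R[i]) : cmeasurable f ->
  cmeasurable (wct mu A w u f).
Proof.
move=> mf; apply: cmeasurableM => //.
by apply: (condexp_cmeasurable Asigma Asub Afin); exact: cmeasurableM.
Qed.

Lemma hoelder_condexp_modulus (f : T -> R[i]) (X F : T -> \bar R) :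
  cmeasurable f ->
  is_condexp mu A (fun x => (modulus (u x * f x)%R)%:E) X ->
  is_condexp mu A (fun x => (modulus (f x) `^ p)%:E) F ->
  energy f < +oo ->
  {ae mu, forall x, X x `^ p <= U x `^ (p / q) * F x} /\
  {ae mu, forall x, X x < +oo}.
Proof.
move=> mf XP FP Ef; have [mF F0 FE] := FP.
have Ffin : {ae mu, forall x, F x < +oo}.
  apply: ae_lty_integral => //; first exact: AmeasT.
  by rewrite FE//; exact: (subalgebra_setT Asigma).
have hoel : {ae mu, forall x, X x `^ p <= U x `^ (p / q) * F x}.
  apply: (condexp_hoelder Asigma Asub Afin (measurable_modulus cu)
    (fun x => modulus_ge0 (u x)) (measurable_modulus mf)
    (fun x => modulus_ge0 (f x)) p1 q1 pq _ UP FP Ufin Ffin).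
  by under eq_fun do rewrite -modulusM.
split=> //; apply: filterS3 hoel Ufin Ffin => x hx Ux Fx.
exact: (poweR_le_mul_lty p0 hx Ux Fx).
Qed.

Lemma conditionable_mul (f : T -> R[i]) : cmeasurable f -> energy f < +oo ->
  conditionable mu A (fun y => (u y * f y)%R).
Proof.
move=> mf Ef; have muf := cmeasurableM cu mf; split => //.
have XP := condexpP Asigma Asub Afin (measurable_modulus muf)
  (fun x => modulus_ge0 (u x * f x)%R).
have [F FP] := condexp_exists Asigma Asub Afin
  (measurable_fun_powR p (measurable_modulus mf)) (fun x => powR_ge0 _ p).
exact: (hoelder_condexp_modulus mf XP FP Ef).2.
Qed.

(** With [X = E|u(f - g)|] and [F = E(|f - g|^p)], the left-hand integrand is at
    most [(4 X)^p |w|^p], then [4^p U^(p/q) F |w|^p] by Hoelder.  The factor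
    [U^(p/q) F] being measurable for the sub-sigma-algebra, [|w|^p] may be
    replaced by [W], and [U^(p/q) W <= C]. *)
Lemma wct_lipschitz (C : R) (f g : T -> R[i]) : (0 <= C)%R ->
  {ae mu, forall x, U x `^ (p / q) * W x <= C%:E} ->
  cmeasurable f -> cmeasurable g ->
  energy (fun x => f x - g x)%R < +oo ->
  energy (fun x => wct mu A w u f x - wct mu A w u g x)%R <=
    (4 `^ p * C)%:E * energy (fun x => f x - g x)%R.
Proof.
move=> C0 JC mf mg Efg; pose D x : R[i] := (f x - g x)%R.
have mD : cmeasurable D by exact: cmeasurableB.
have [X XP] := condexp_exists Asigma Asub Afin
  (measurable_modulus (cmeasurableM cu mD)) (fun x => modulus_ge0 (u x * D x)%R).
have [F FP] := condexp_exists Asigma Asub Afin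
  (measurable_fun_powR p (measurable_modulus mD)) (fun x => powR_ge0 _ p).
have [hoel Xfin] := hoelder_condexp_modulus mD XP FP Efg.
have [_ X0 _] := XP; have [mF F0 FE] := FP.
have [mU U0 _] := UP; have [mW W0 _] := WP.
pose H x := U x `^ (p / q) * F x.
have mH : measurable_fun [set: TA] H.
  apply: emeasurable_funM => //.
  exact: (measurableT_comp (@measurable_poweR R (p / q)) mU).
have H0 x : 0 <= H x by rewrite mule_ge0// poweR_ge0.
have diff : {ae mu, forall x, (modulus (condexp mu A (fun y => (u y * f y)%R) x -
    condexp mu A (fun y => (u y * g y)%R) x))%:E <= 4%:E * X x}.
  apply: (condexpB_le Asigma Asub Afin) => //; try exact: cmeasurableM.
  rewrite (_ : (fun x => _) = fun x => (modulus (u x * D x)%R)%:E)//.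
  by apply/funext => x; rewrite -mulrBr.
apply: (@le_trans _ _ (\int[mu]_x ((4 `^ p)%:E * (H x * (modulus (w x) `^ p)%:E)))).
  apply: ae_ge0_le_integral => //.
  - by move=> x _; exact: modulus_powR_ge0.
  - apply: measurable_modulus_powR.
    by apply: cmeasurableB; exact: measurable_wct.
  - by move=> x _; rewrite mule_ge0 ?lee_fin ?powR_ge0// mule_ge0 ?lee_fin ?powR_ge0.
  - apply: emeasurable_funM => //; apply: emeasurable_funM; first exact: AmeasT.
    exact: measurable_modulus_powR.
  apply: filterS3 diff hoel Xfin => x dx hx Xx _.
  have XE : X x = (fine (X x))%:E by rewrite fineK// ge0_fin_numE.
  rewrite /wct -mulrBr modulusM powRM ?modulus_ge0// EFinM [leLHS]muleC muleA.
  rewrite lee_wpmul2r// ?modulus_powR_ge0//.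
  apply: le_trans (lee_wpmul2l _ hx); last by rewrite lee_fin powR_ge0.
  move: dx; rewrite XE poweR_EFin -!EFinM !lee_fin => dx.
  rewrite -powRM ?fine_ge0//; apply: ge0_ler_powR => //; first exact: ltW.
  - by rewrite nnegrE modulus_ge0.
  - by rewrite nnegrE mulr_ge0// fine_ge0.
rewrite ge0_integralZl//; last 2 first.
- apply: emeasurable_funM; [exact: AmeasT|exact: measurable_modulus_powR].
- by move=> x _; rewrite mule_ge0// modulus_powR_ge0.
rewrite EFinM -muleA lee_wpmul2l ?lee_fin ?powR_ge0//.
rewrite (condexp_pull_out Asigma Asub (subalgebra_setT Asigma)
  (measurable_modulus_powR p cw) (fun x => modulus_powR_ge0 p (w x)) WP mH H0).
apply: (@le_trans _ _ (\int[mu]_x (C%:E * F x))).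
  apply: ae_ge0_le_integral => //.
  - by move=> x _; rewrite mule_ge0.
  - by apply: AmeasT; exact: emeasurable_funM.
  - by move=> x _; rewrite mule_ge0.
  - by apply: AmeasT; exact: emeasurable_funM.
  apply: filterS JC => x JC _; rewrite /H muleAC.
  exact: lee_wpmul2r.
rewrite ge0_integralZl//; last exact: AmeasT.
by rewrite FE//; exact: (subalgebra_setT Asigma).
Qed.

Section test_functions.
Variable h : T -> R.
Hypotheses (mh : measurable_fun [set: TA] h) (h0 : forall x, (0 <= h x)%R).

Let hTm : measurable_fun [set: T] h := AmeasT mh.

Lemma energy_aligned : energy (aligned h) = \int[mu]_x ((h x `^ p)%:E * U x).
Proof.
rewrite -(condexp_pull_out Asigma Asub (subalgebra_setT Asigma)
  (measurable_modulus_powR q cu) (fun x => modulus_powR_ge0 q (u x)) UP).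
- by apply: eq_integral => x _; rewrite modulus_aligned// EFinM.
- by apply/measurable_EFinP; exact: measurable_fun_powR.
- by move=> x; rewrite lee_fin powR_ge0.
Qed.

Let phi x := (h x * modulus (u x) `^ q)%R.

Let mphi : measurable_fun [set: T] phi.
Proof.
apply: measurable_funM => //; apply: measurable_fun_powR.
exact: measurable_modulus.
Qed.

Let phi0 x : (0 <= phi x)%R. Proof. by rewrite mulr_ge0// powR_ge0. Qed.

Lemma condexp_phi : {ae mu, forall x,
  condexp_ge0 mu A (EFin \o phi) x = (h x)%:E * U x}.
Proof.
apply: (condexp_mul Asigma Asub Afin (measurable_modulus_powR q cu)
  (fun x => modulus_powR_ge0 q (u x)) UP).
- exact/measurable_EFinP.
- by move=> x; rewrite lee_fin.
- have := condexpP Asigma Asub Afin mphi phi0.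
  by rewrite (_ : EFin \o phi = fun x => (h x)%:E * (modulus (u x) `^ q)%:E).
Qed.

Lemma condexp_zero : {ae mu, forall x,
  condexp_ge0 mu A (EFin \o (fun _ : T => 0%R : R)) x = 0}.
Proof.
have zP := condexpP Asigma Asub Afin (@measurable_cst _ _ T R setT 0%R) (fun _ => lexx 0%R).
have := @condexp_mul _ _ _ mu A Asigma Asub Afin _ U
   (condexp_ge0 mu A (EFin \o (fun _ : T => 0%R : R))) (cst 0)
  (measurable_modulus_powR q cu) (fun x => modulus_powR_ge0 q (u x)) UP.
move=> /(_ (measurable_cst _) (fun _ => lexx 0)).
move=> zE; have {zE} : {ae mu, forall x,
    condexp_ge0 mu A (EFin \o (fun _ : T => 0%R : R)) x = cst 0 x * U x}.
  apply: zE; rewrite (_ : (fun x => _) = EFin \o (fun _ : T => 0%R : R))//.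
  by apply/funext => x /=; rewrite mul0e.
by apply: filterS => x ->; rewrite mul0e.
Qed.

Lemma condexp_aligned : {ae mu, forall x,
  condexp mu A (fun y => (u y * aligned h y)%R) x = ((h x * fine (U x))%:C)%C}.
Proof.
have reE : (fun y => complex.Re (u y * aligned h y)%R) = phi.
  by apply/funext => y; rewrite mul_aligned.
have imE : (fun y => complex.Im (u y * aligned h y)%R) = (fun=> 0%R).
  by apply/funext => y; rewrite mul_aligned.
have phip : phi^\+%R = phi.
  by apply/funext => x; rewrite /funrpos max_l.
have phin : phi^\-%R = (fun=> 0%R).
  by apply/funext => x; rewrite /funrneg max_r// oppr_le0.
have zp : ((fun=> 0%R) : T -> R)^\+%R = ((fun=> 0%R) : T -> R).
  by apply/funext => x; rewrite /funrpos max_l.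
have zn : ((fun=> 0%R) : T -> R)^\-%R = ((fun=> 0%R) : T -> R).
  by apply/funext => x; rewrite /funrneg oppr0 max_l.
apply: filterS3 condexp_phi condexp_zero Ufin => x phiE zE Ux.
have [_ U0 _] := UP.
rewrite /condexp reE imE /condexp_real phip phin zp zn subrr phiE zE.
have -> : U x = (fine (U x))%:E by rewrite fineK// ge0_fin_numE.
by rewrite /= subr0.
Qed.

(** Here [E(u f) = h U], and [U^p = U^(p/q) U] because [p = p/q + 1]. *)
Lemma energy_wct_aligned : energy (wct mu A w u (aligned h)) =
  \int[mu]_x ((h x `^ p)%:E * (U x `^ (p / q) * W x * U x)).
Proof.
have [mU U0 _] := UP; have [mW W0 _] := WP.
pose k x := ((h x * fine (U x)) `^ p)%R.
have mk : measurable_fun [set: TA] (EFin \o k).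
  apply/measurable_EFinP; apply: measurable_fun_powR; apply: measurable_funM => //.
  exact: measurableT_comp.
have k0 x : 0 <= (EFin \o k) x by rewrite lee_fin powR_ge0.
transitivity (\int[mu]_x ((EFin \o k) x * (modulus (w x) `^ p)%:E)).
  apply: ge0_ae_eq_integral => //.
  - apply: measurable_modulus_powR; apply: measurable_wct.
    exact: measurable_aligned.
  - by apply: emeasurable_funM; [exact: AmeasT|exact: measurable_modulus_powR].
  - by move=> x _; exact: modulus_powR_ge0.
  - by move=> x _; rewrite mule_ge0// modulus_powR_ge0.
  apply: filterS condexp_aligned => x E _; rewrite /wct E.
  rewrite modulusM modulus_real ger0_norm ?mulr_ge0 ?fine_ge0//.
  by rewrite powRM ?modulus_ge0 ?mulr_ge0 ?fine_ge0// EFinM muleC.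
rewrite (condexp_pull_out Asigma Asub (subalgebra_setT Asigma)
  (measurable_modulus_powR p cw) (fun x => modulus_powR_ge0 p (w x)) WP mk k0).
apply: ge0_ae_eq_integral => //.
- by apply: AmeasT; exact: emeasurable_funM.
- apply: AmeasT; apply: emeasurable_funM.
    by apply/measurable_EFinP; exact: measurable_fun_powR.
  apply: emeasurable_funM => //; apply: emeasurable_funM => //.
  exact: (measurableT_comp (@measurable_poweR R (p / q)) mU).
- by move=> x _; rewrite mule_ge0.
- move=> x _; rewrite mule_ge0 ?lee_fin ?powR_ge0// mule_ge0// mule_ge0//.
  exact: poweR_ge0.
apply: filterS Ufin => x Ux _.
have UE : U x = (fine (U x))%:E by rewrite fineK// ge0_fin_numE.
rewrite /k /= UE poweR_EFin; move: (fine_ge0 (U0 x)); move: (fine (U x)) => v v0.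
have pE : p = (p / q + 1)%R.
  by rewrite -[LHS]mulr1 -[X in (p * X)%R]pq mulrDr mulfV ?gt_eqF// addrC.
have -> : ((h x * v) `^ p = h x `^ p * (v `^ (p / q) * v))%R.
  rewrite powRM//; congr (_ * _)%R; rewrite {1}pE powRD ?powRr1//.
  by rewrite gt_eqF// addr_gt0// divr_gt0.
by rewrite !EFinM -!muleA; congr (_ * (_ * _)); rewrite muleC.
Qed.

Lemma conditionable_aligned :
  conditionable mu A (fun y => (u y * aligned h y)%R).
Proof.
split; first by apply: cmeasurableM => //; exact: measurable_aligned.
have [_ U0 _] := UP.
have -> : (fun y => (modulus (u y * aligned h y)%R)%:E) = EFin \o phi.
  by apply/funext => y; rewrite mul_aligned modulus_real ger0_norm ?phi0//; exact: phi0.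
apply: filterS2 condexp_phi Ufin => x -> Ux.
by apply: lte_mul_pinfty => //; rewrite lee_fin.
Qed.

End test_functions.

Let J x := U x `^ (p / q) * W x.

Hypothesis Jfin : {ae mu, forall x, J x < +oo}.

Let mU : measurable_fun [set: TA] U. Proof. by case: UP. Qed.
Let U0 x : 0 <= U x. Proof. by case: UP. Qed.

Let mJ : measurable_fun [set: TA] J.
Proof.
apply: emeasurable_funM; last by case: WP.
exact: (measurableT_comp (@measurable_poweR R (p / q)) mU).
Qed.

Let J0 x : 0 <= J x.
Proof. by apply: mule_ge0; [exact: poweR_ge0|case: WP]. Qed.

(* As [0 * +oo = 0], this holds even where [W] is infinite. *)
Let UJ0 x : U x = 0 -> J x = 0.
Proof. by move=> Ux; rewrite /J Ux poweR0r ?mul0e// gt_eqF// divr_gt0. Qed.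

Lemma cLp_energy (f : T -> R[i]) :
  cLp mu p f <-> cmeasurable f /\ energy f < +oo.
Proof. by rewrite /cLp /= cLnorm_lty. Qed.

Lemma energy0 : energy (fun=> 0%R) = 0.
Proof.
apply: integral0_eq => x _.
by rewrite modulusE /= expr0n addr0 sqrtr0 powR0 ?gt_eqF.
Qed.

Lemma wct0 : wct mu A w u (fun=> 0%R) = (fun=> 0%R).
Proof.
apply/funext => x; rewrite /wct /condexp.
under eq_fun do rewrite mulr0.
under [X in (_ +i* condexp_real _ _ X _)%C]eq_fun do rewrite mulr0.
have -> : condexp_real mu A (fun=> 0%R) x = 0%R.
  rewrite /condexp_real.
  rewrite (_ : ((fun=> 0%R) : T -> R)^\-%R = ((fun=> 0%R) : T -> R)^\+%R) ?subrr//.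
  by apply/funext => y; rewrite /funrneg /funrpos oppr0.
by rewrite mulr0.
Qed.

Lemma wct_dom_energy (f : T -> R[i]) : wct_dom mu A p w u f <->
  [/\ cmeasurable f, energy f < +oo, conditionable mu A (fun y => (u y * f y)%R) &
    energy (wct mu A w u f) < +oo].
Proof.
split=> [[/cLp_energy[cf Ef] cond /cLp_energy[_ Ew]]|[cf Ef cond Ew]].
  exact: And4 cf Ef cond Ew.
split; [exact/cLp_energy|exact: cond|apply/cLp_energy].
by split; [exact: measurable_wct|exact: Ew].
Qed.

Lemma wct_dom0 : wct_dom mu A p w u (fun=> 0%R).
Proof.
apply/wct_dom_energy; rewrite wct0 energy0; split => //.
apply: (conditionable_mul) => //.
by rewrite energy0.
Qed.

(** The aligned function with [h = k^(1/p)], so that [h^p] is the weight [k]. *)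
Lemma exists_test_function (k : T -> R) :
  measurable_fun [set: TA] k -> (forall x, 0 <= k x)%R ->
  exists f : T -> R[i], [/\ cmeasurable f,
    conditionable mu A (fun y => (u y * f y)%R),
    energy f = \int[mu]_x ((k x)%:E * U x) &
    energy (wct mu A w u f) = \int[mu]_x ((k x)%:E * (J x * U x))].
Proof.
move=> mk k0; pose h x := (k x `^ p^-1)%R.
have mh : measurable_fun [set: TA] h by exact: measurable_fun_powR.
have h0 x : (0 <= h x)%R by exact: powR_ge0.
have hp x : (h x `^ p)%R = k x by rewrite -powRrM mulVf ?gt_eqF// powRr1.
exists (aligned h); split.
- by apply: measurable_aligned => //; exact: (subalgebra_measurable_fun Asigma Asub).
- exact: (conditionable_aligned).
- rewrite (energy_aligned mh h0).
  by apply: eq_integral => x _; rewrite hp.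
- rewrite (energy_wct_aligned mh h0).
  by apply: eq_integral => x _; rewrite hp.
Qed.

Lemma symbol_bounded_of_continuous :
  Lp_continuous_on mu p (wct_dom mu A p w u) (wct mu A w u) ->
  exists2 C : R, (0 <= C)%R & {ae mu, forall x, J x <= C%:E}.
Proof.
move=> /(_ _ wct_dom0 1%R ltr01)[r r0 cont].
pose s := ((r / 2) `^ p)%R.
have r20 : (0 < r / 2)%R by rewrite divr_gt0.
have s0 : (0 < s)%R by exact: powR_gt0.
(* A weight of mass [s] at level [s^-1] has an image of energy at least 1. *)
have C0 : (0 <= s^-1)%R by rewrite invr_ge0 ltW.
exists s^-1%R => //; apply: contrapT => unb.
have [k [mk k0 kU kJU kJUoo]] := concentrated_weight Asigma Asub Afin
  mU U0 mJ J0 UJ0 Ufin Jfin C0 s0 unb.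
have [f [cf condf Ef Ewf]] := exists_test_function mk k0.
have domf : wct_dom mu A p w u f.
  by apply/wct_dom_energy; rewrite Ewf Ef kU ltry.
have := cont f domf.
under eq_fun do rewrite subr0; rewrite wct0.
under [X in _ -> is_true (cLnorm _ _ X < _)]eq_fun do rewrite subr0.
rewrite !cLnorm_lt// Ef Ewf kU powR1 lte_fin.
have -> : (s < r `^ p)%R.
  apply: gt0_ltr_powR => //; rewrite ?nnegrE ?ltW//.
  by rewrite ltr_pdivrMr// ltr_pMr// ltr1n.
move=> /(_ isT); rewrite ltNge => /negP; apply.
by rewrite mulVf ?gt_eqF in kJU.
Qed.

Lemma symbol_bounded_of_total :
  wct_dom mu A p w u = cLp mu p ->
  exists2 C : R, (0 <= C)%R & {ae mu, forall x, J x <= C%:E}.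
Proof.
move=> total; apply: contrapT => unb.
have [|k [mk k0 kU kJU]] := resonant_weight Asigma Asub Afin
  mU U0 mJ J0 UJ0 Ufin Jfin.
  by move=> C C0 JC; apply: unb; exists C.
have [f [cf condf Ef Ewf]] := exists_test_function mk k0.
have : cLp mu p f by apply/cLp_energy; rewrite Ef.
by rewrite -total => /wct_dom_energy[_ _ _]; rewrite Ewf kJU ltxx.
Qed.

Lemma wct_dom_total (C : R) : (0 <= C)%R ->
  {ae mu, forall x, J x <= C%:E} -> wct_dom mu A p w u = cLp mu p.
Proof.
move=> C0 JC; apply/seteqP; split => f; first by case.
move=> /cLp_energy[cf Ef]; apply/wct_dom_energy.
apply: (And4 cf Ef).
  exact: (conditionable_mul).
have sub0 (g : T -> R[i]) : (fun x => (g x - 0)%R) = g.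
  by apply/funext => x; rewrite subr0.
have := wct_lipschitz C0 JC cf
  cmeasurable0.
rewrite wct0 !sub0 => /(_ Ef)/le_lt_trans; apply.
by rewrite lte_mul_pinfty// lee_fin mulr_ge0// powR_ge0.
Qed.

Lemma wct_continuous (C : R) : (0 <= C)%R ->
  {ae mu, forall x, J x <= C%:E} ->
  Lp_continuous_on mu p (wct_dom mu A p w u) (wct mu A w u).
Proof.
move=> C0 JC f /wct_dom_energy[cf _ _ _] e e0.
(* The modulus of continuity uses [M + 1], as [M] may be 0. *)
pose M := (4 `^ p * C)%R.
have M0 : (0 <= M)%R by rewrite mulr_ge0// powR_ge0.
have M10 : (0 < M + 1)%R by rewrite ltr_wpDl.
have ep0 : (0 < e `^ p)%R by exact: powR_gt0.
exists ((e `^ p / (M + 1)) `^ p^-1)%R; first by rewrite powR_gt0// divr_gt0.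
move=> g /wct_dom_energy[cg _ _ _].
rewrite !cLnorm_lt ?powR_gt0 ?divr_gt0//.
rewrite -powRrM mulVf ?gt_eqF// powRr1 ?divr_ge0 ?ltW// => Egf.
have Efin := lt_trans Egf (ltry _).
apply: le_lt_trans (wct_lipschitz C0 JC
  cg cf Efin) _.
have E0 := Lp_energy_ge0 mu p (fun x => (g x - f x)%R).
move: Egf E0; case: (energy _) Efin => [t| |]// _.
rewrite -EFinM !lte_fin lee_fin ltr_pdivlMr// -/M => tlt t0.
by apply: le_lt_trans tlt; rewrite mulrC ler_wpM2l// lerDl.
Qed.

End wct_operator.

(* The second conjunct of [Hfin] says that the product is not of the form
   oo * 0, which would count as 0 < +oo in \bar R. It is needed: with w = 0
   and A trivial over a probability space, the operator is 0, hence
   continuous, but its domain is not L^p when u is in L^1 and not in L^q. The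
   form 0 * oo is not excluded and counts as 0. *)
Theorem theorem2p6 (d : measure_display) (T : measurableType d) (R : realType)
    (mu : {sigma_finite_measure set T -> \bar R})
    (A : set (set T)) (Asigma : sigma_algebra [set: T] A)
    (Asub : A `<=` @measurable d T)
    (Afin : sigma_finite [set: g_sigma_algebraType A] mu)
    (u w : T -> R[i])
    (Hu : conditionable mu A u) (Hw : conditionable mu A w)
    (p q : R) (Hp : 1 < p) (Hq : 1 < q) (Hpq : p^-1 + q^-1 = 1)
    (Hfin : {ae mu, forall x,
      let Eu := condexp_ge0 mu A (fun y => (modulus (u y) `^ q)%:E) x in
      let Ew := condexp_ge0 mu A (fun y => (modulus (w y) `^ p)%:E) x in
      (Eu `^ (p / q) * Ew < +oo)%E /\ ~ (Eu = +oo%E /\ Ew = 0%E)}) :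
  Lp_continuous_on mu p (wct_dom mu A p w u) (wct mu A w u) <->
  wct_dom mu A p w u = cLp mu p.
Proof.
have [[cu _] [cw _]] := (Hu, Hw).
have condP (r : R) (f : T -> R[i]) : cmeasurable f ->
    is_condexp mu A (fun y => (modulus (f y) `^ r)%:E)
      (condexp_ge0 mu A (fun y => (modulus (f y) `^ r)%:E)).
  move=> cf; apply: (condexpP Asigma Asub Afin) => [|x]; last exact: powR_ge0.
  by apply: measurable_fun_powR; exact: measurable_modulus.
have := condP q u cu; have := condP p w cw; move: Hfin => /=.
move: (condexp_ge0 _ _ _) => U; move: (condexp_ge0 _ _ _) => W.
move=> UWfin WP UP; have [_ W0 _] := WP.
have Jfin : {ae mu, forall x, (U x `^ (p / q) * W x < +oo)%E}.
  by apply: filterS UWfin => x [].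
have Ufin : {ae mu, forall x, (U x < +oo)%E}.
  apply: filterS UWfin => x [UWx not0]; rewrite ltey; apply/eqP => Uoo.
  have W_neq0 : (W x != 0)%E by apply/eqP => Wx0; apply: not0.
  move: UWx; rewrite Uoo poweRyr ?gt_eqF ?divr_gt0 ?(lt_trans ltr01)//.
  by rewrite gt0_mulye// lt0e W_neq0 W0.
split=> [cont|total].
  have [C C0 JC] := symbol_bounded_of_continuous Asigma Asub Afin cu cw Hp Hq Hpq
    UP WP Ufin Jfin cont.
  exact: (wct_dom_total Asigma Asub Afin cu cw Hp Hq Hpq UP WP Ufin C0 JC).
have [C C0 JC] := symbol_bounded_of_total Asigma Asub Afin cu cw Hp Hq Hpq
  UP WP Ufin Jfin total.
exact: (wct_continuous Asigma Asub Afin cu cw Hp Hq Hpq UP WP Ufin C0 JC).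
Qed.
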